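(* Let $n$ and $r$ be positive integers and let $G$ be a group from the Higman–Thompson families $\{F_{n,r}\}$, $\{G_{n,r}\}$ such that $G$ is simple. Then any non-trivial measure-preserving ergodic action of $G$ on a probability measure space $(X,\mu)$ is essentially free, i.e. $\mu(\mathrm{Fix}(g))=0$ for every $g\in G\setminus\{e\}$, where $\mathrm{Fix}(g)=\{x\in X: g(x)=x\}$.
   Context: $\mathbb{Z}[1/n]=\{p/n^k : p,k\in\mathbb{N}\}$. For positive integers $n$ and $r$, $F_{n,r}$ is the group of all orientation-preserving piecewise linear homeomorphisms $h$ of $[0,r]$ such that all singularities of $h$ are in $\mathbb{Z}[1/n]$ and the derivative of $h$ at any non-singular point is $n^k$ for some $k\in\mathbb{Z}$. For positive integers $n$ and $r$, $G_{n,r}$ is the group of all right-continuous bijections of $[0,r)$ which are piecewise linear, with finitely many discontinuities and singularities, all in $\mathbb{Z}[1/n]$, with slopes in $\{n^k:k\in\mathbb{Z}\}$, and which map $\mathbb{Z}[1/n]\cap[0,r)$ to itself. An action of $G$ on a measure space $(X,\mu)$ is trivial if $g(x)=x$ for every $g\in G$ and $\mu$-almost every $x\in X$.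
   Formalization: The formal theorem assumes in addition that Fix(g) is measurable for every g in G; on an arbitrary probability space μ(Fix(g)) may otherwise be undefined (e.g. G_{2,1} acting on [0,1) with the trivial σ-algebra). This is automatic on standard Borel and Lebesgue spaces. *)

(* Defs.v *)
From HB Require Import structures.
From mathcomp Require Import all_boot all_order all_algebra.
From mathcomp Require Import all_classical all_reals all_analysis.
From mathcomp Require Import ring lra.
Set Implicit Arguments.
Unset Strict Implicit.
Unset Printing Implicit Defensive.
Import Order.TTheory GRing.Theory Num.Theory.
Import numFieldNormedType.Exports.
Local Open Scope classical_set_scope.
Local Open Scope ring_scope.

Record permgroup (T : Type) := PermGroup {
  pg_set : set (T -> T) ;
  pg_id : pg_set id ;
  pg_comp : forall f g, pg_set f -> pg_set g -> pg_set (f \o g) ;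
  pg_inv : forall f, pg_set f ->
    exists g, [/\ pg_set g, cancel f g & cancel g f] }.

Record pg_type (T : Type) (P : permgroup T) := PgElt {
  pg_fun :> T -> T ;
  pg_funP : pg_set P pg_fun }.

Section PermGroupTheory.
Variables (T : Type) (P : permgroup T).
Implicit Types f g h : pg_type P.

HB.instance Definition _ := gen_eqMixin (pg_type P).
HB.instance Definition _ := gen_choiceMixin (pg_type P).

Lemma pg_eq f g : pg_fun f =1 pg_fun g -> f = g.
Proof.
case: f g => [f Pf] [g Pg] /= /funext fg; rewrite -fg in Pg *.
by congr PgElt; exact: Prop_irrelevance.
Qed.

Definition pg_one := PgElt (pg_id P).
Definition pg_mul f g := PgElt (pg_comp (pg_funP f) (pg_funP g)).
Definition pg_invf f := projT1 (cid (pg_inv (pg_funP f))).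

Lemma pg_invfP f : [/\ pg_set P (pg_invf f), cancel f (pg_invf f)
  & cancel (pg_invf f) f].
Proof. exact: (projT2 (cid (pg_inv (pg_funP f)))). Qed.

Definition pg_invg f := PgElt (let: And3 p _ _ := pg_invfP f in p).

Fact pg_mulA : associative pg_mul. Proof. by move=> f g h; exact: pg_eq. Qed.
Fact pg_mul1 : left_id pg_one pg_mul. Proof. by move=> f; exact: pg_eq. Qed.
Fact pg_mulr1 : right_id pg_one pg_mul. Proof. by move=> f; exact: pg_eq. Qed.
Fact pg_mulV : left_inverse pg_one pg_invg pg_mul.
Proof. by move=> f; apply: pg_eq => x /=; have [_ -> _] := pg_invfP f. Qed.
Fact pg_mulrV : right_inverse pg_one pg_invg pg_mul.
Proof. by move=> f; apply: pg_eq => x /=; have [_ _ ->] := pg_invfP f. Qed.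

HB.instance Definition _ :=
  isGroup.Build (pg_type P) pg_mulA pg_mul1 pg_mulr1 pg_mulV pg_mulrV.

End PermGroupTheory.

Section HigmanThompson.
Variables (R : realType) (n r : nat).
Implicit Types (h g : R -> R) (x y : R).

(* As p ranges over the natural numbers, this is the nonnegative part of the
   usual ring Z[1/n]. *)
Definition nadic : set R :=
  [set x | exists p k : nat, x = p%:R / n%:R ^+ k].

Definition locally_affine h x :=
  exists c : R, \forall y \near x, h y = h x + c * (y - x).

(* The endpoints 0 and r are never counted as singularities; points of
   discontinuity in the open interval ]0, r[ always are. *)
Definition singularities h : set R :=
  [set x | 0 < x < r%:R /\ ~ locally_affine h x].

Definition nadic_PL h :=
  [/\ finite_set (singularities h), singularities h `<=` nadic &
   forall x, 0 < x < r%:R -> ~ singularities h x ->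
     exists k : int, derive1 h x = n%:R ^ k].

(* A bijection of [0, r] or of [0, r[ is encoded as a function on the whole
   line that is the identity outside this interval, so that equality of
   encodings is equality of maps. *)
Definition F_set : set (R -> R) := [set h : R -> R |
  [/\ set_bij `[0, r%:R] `[0, r%:R] h,
      {within `[0, r%:R], continuous h},
      {in `[0, r%:R] &, {homo h : x y / x < y}},
      nadic_PL h &
      forall x, x \notin `[0, r%:R] -> h x = x]].

Definition G_set : set (R -> R) := [set h : R -> R |
  [/\ set_bij `[0, r%:R[ `[0, r%:R[ h,
      {in `[0, r%:R[, forall x, h y @[y --> x^'+] --> h x},
      nadic_PL h,
      h @` (nadic `&` `[0, r%:R[) = nadic `&` `[0, r%:R[ &
      forall x, x \notin `[0, r%:R[ -> h x = x]].

Hypothesis n_gt0 : (0 < n)%N.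

Let nR_gt0 : 0 < n%:R :> R. Proof. by rewrite ltr0n. Qed.
Let nX_gt0 (k : int) : 0 < n%:R ^ k :> R. Proof. exact: exprz_gt0. Qed.

Lemma nadic_ge0 x : nadic x -> 0 <= x.
Proof. by move=> [p [k ->]]; rewrite divr_ge0 ?ler0n ?exprn_ge0. Qed.

Lemma nadic0 : nadic 0. Proof. by exists 0%N, 0%N; rewrite mul0r. Qed.

Lemma nadicD x y : nadic x -> nadic y -> nadic (x + y).
Proof.
move=> [p [k ->]] [q [l ->]]; exists (p * n ^ l + q * n ^ k)%N, (k + l)%N.
rewrite natrD !natrM !natrX exprD.
by field; rewrite !expf_neq0 ?gt_eqF.
Qed.

Lemma nadicB x y : x <= y -> nadic x -> nadic y -> nadic (y - x).
Proof.
move=> + [p [k xE]] [q [l yE]]; rewrite -subr_ge0 => xy.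
have E : y - x = ((q * n ^ k)%N%:R - (p * n ^ l)%N%:R) / n%:R ^+ (k + l).
  rewrite xE yE !natrM !natrX exprD.
  by field; rewrite !expf_neq0 ?gt_eqF.
exists (q * n ^ k - p * n ^ l)%N, (k + l)%N; rewrite natrB -?E//.
by rewrite -(ler_nat R) -subr_ge0; move: xy;
  rewrite E pmulr_lge0 // invr_gt0 exprn_gt0.
Qed.

Lemma nadicM (k : int) x : nadic x -> nadic (n%:R ^ k * x).
Proof.
move=> [p [l ->]]; case: k => k.
  exists (n ^ k * p)%N, l; rewrite natrM natrX -exprnP.
  by rewrite mulrA.
exists p, (k.+1 + l)%N; rewrite NegzE -exprz_inv -exprnP exprVn exprD.
by field; rewrite !expf_neq0 ?gt_eqF.
Qed.

Lemma nadicMV (k : int) x : nadic (n%:R ^ k * x) -> nadic x.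
Proof.
move=> /(nadicM (- k)); rewrite mulrA -expfzDr ?gt_eqF//.
by rewrite addrC subrr expr0z mul1r.
Qed.

Definition aff h x (c : R) :=
  exists2 e : R, 0 < e & forall y, `|y - x| < e -> h y = h x + c * (y - x).

Lemma affP h x (c : R) :
  (\forall y \near x, h y = h x + c * (y - x)) <-> aff h x c.
Proof.
split=> [/nbhs_ballP[e /= e0 H]|[e e0 H]].
  by exists e => // y; rewrite distrC => /H.
by apply/nbhs_ballP; exists e => // y /=; rewrite /ball/= distrC => /H.
Qed.

Lemma aff_derive h x (c : R) : aff h x c -> is_derive x 1 h c.
Proof.
move=> /affP hc.
apply: (@near_eq_is_derive _ _ _ (fun y => h x + c * (y - x))).
  by near=> y; apply/esym; near: y.
apply: is_derive_eq.
by rewrite /GRing.scale /=; ring.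
Unshelve. all: by end_near. Qed.

Lemma aff_near h x (c : R) : aff h x c ->
  exists2 e : R, 0 < e & forall y, `|y - x| < e -> aff h y c.
Proof.
move=> [e e0 H]; exists e => // y ye; exists (e - `|y - x|).
  by rewrite subr_gt0.
move=> z zy; rewrite (H _ ye) H; first by ring.
have -> : z - x = (z - y) + (y - x) by ring.
by apply: le_lt_trans (ler_normD _ _) _; lra.
Qed.

Lemma aff_continuous h x (c : R) : aff h x c -> {for x, continuous h}.
Proof.
move=> /aff_derive [] /derivable1_diffP /differentiable_continuous.
by [].
Qed.

Definition reg h x := exists k : int, aff h x (n%:R ^ k).

Lemma nadic_PL_reg h x : nadic_PL h -> 0 < x < r%:R -> ~ singularities h x ->
  reg h x.
Proof.
move=> [_ _ H] xr xs; have [k hk] := H _ xr xs.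
have [c /affP hc] : locally_affine h x by apply: contrapT => ?; apply: xs.
exists k; rewrite -hk derive1E.
by have [_ ->] := aff_derive hc.
Qed.

Lemma finite_gap (S : set R) x (b : R) : finite_set S -> x < b ->
  exists2 d : R, 0 < d & x + d <= b /\ forall y, x < y < x + d -> ~ S y.
Proof.
move=> /finite_seqP[s ->] xb; elim: s => [|p s [d d0 [db H]]].
  by exists (b - x); [lra|split; [lra|]].
have [px|xp] := leP p x.
  exists d => //; split=> // y yd; rewrite /= in_cons => /orP[/eqP yp|/(H _ yd)//].
  by move: yd; rewrite yp; lra.
exists (Num.min d (p - x)); first by rewrite lt_min d0 subr_gt0.
have m1 : Num.min d (p - x) <= d by rewrite ge_min lexx.
have m2 : Num.min d (p - x) <= p - x by rewrite ge_min lexx orbT.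
split; first by lra.
move=> y yd; rewrite /= in_cons => /orP[/eqP yp|]; first by move: yd; lra.
by apply: H; lra.
Qed.

Lemma MVT_lin (f : R -> R) (c a b : R) : a < b ->
  (forall x, x \in `]a, b[ -> is_derive x 1 f c) ->
  {within `[a, b], continuous f} -> f b - f a = c * (b - a).
Proof.
move=> ab fc fcont.
by have [c' _ ->] := @MVT R f (fun=> c) a b ab fc fcont.
Qed.

Lemma MVT_const (f : R -> R) (a b : R) : a < b ->
  (forall x, x \in `[a, b] -> is_derive x 1 f 0) -> f a = f b.
Proof.
move=> ab f0.
have f1 x : x \in `]a, b[ -> is_derive x 1 f 0.
  by move=> xab; apply: f0; exact: subset_itv_oo_cc xab.
have f2 : {within `[a, b], continuous f}.
  by apply: derivable_within_continuous => x /f0[].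
have := MVT_lin ab f1 f2.
by rewrite mul0r => /eqP; rewrite subr_eq0 => /eqP.
Qed.

Lemma reg_slope h (a b : R) : a < b ->
  (forall y, a < y < b -> reg h y) ->
  exists k : int, forall y, a < y < b -> aff h y (n%:R ^ k).
Proof.
move=> ab H.
have mid : a < (a + b) / 2 < b by lra.
have [k hk] := H _ mid; exists k.
have der y (l : int) : aff h y (n%:R ^ l) -> is_derive y 1 (derive1 h) 0.
  move=> /aff_near[e e0 he].
  apply: (@near_eq_is_derive _ _ _ (cst (n%:R ^ l : R) : R -> R)).
    apply/nbhs_ballP; exists e => // z; rewrite /ball /= distrC => /he hz.
    by rewrite derive1E; have [_ ->] := aff_derive hz.
have cst_ y z : a < y < b -> a < z < b -> y < z -> derive1 h y = derive1 h z.
  move=> yab zab yz.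
  have sub w : w \in `[y, z] -> is_derive w 1 (derive1 h) 0.
    rewrite in_itv /= => wyz; have [l hl] : reg h w by apply: H; lra.
    exact: der hl.
  exact: (MVT_const yz sub).
have val y : reg h y -> aff h y (derive1 h y).
  by move=> [l hl]; rewrite derive1E; have [_ ->] := aff_derive hl.
have -> : n%:R ^ k = (derive1 h) ((a + b) / 2).
  by rewrite derive1E; have [_ ->] := aff_derive hk.
move=> y yab; have := val _ (H _ yab).
case: (ltrgtP y ((a + b) / 2)) => [/cst_ ->//| /cst_ <-//|-> //].
Qed.

Lemma reg_MVT h (a b : R) : a < b -> {within `[a, b], continuous h} ->
  (forall y, a < y < b -> reg h y) ->
  exists k : int, h b - h a = n%:R ^ k * (b - a).
Proof.
move=> ab hc hr; have [k hk] := reg_slope ab hr; exists k.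
have hd x : x \in `]a, b[ -> is_derive x 1 h (n%:R ^ k).
  by rewrite in_itv /= => /hk /aff_derive.
exact: MVT_lin ab hd hc.
Qed.

Definition raff h x := exists k : int, exists2 d : R, 0 < d &
  forall y, x <= y < x + d -> h y = h x + n%:R ^ k * (y - x).

Lemma PL_raff h x : nadic_PL h -> 0 <= x < r%:R ->
  h y @[y --> x^'+] --> h x -> raff h x.
Proof.
move=> hPL /andP[x0 xr] hx; have [fS _ _] := hPL.
have [d d0 [dr H]] := finite_gap fS xr.
have xd : x < x + d by lra.
have [|k hk] := reg_slope xd (h := h).
  by move=> y yd; apply: nadic_PL_reg (H _ yd) => //; lra.
exists k, d => // y /andP[]; rewrite le_eqVlt => /orP[/eqP <-|xy yd].
  by rewrite subrr mulr0 addr0.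
have E : h y - h x = n%:R ^ k * (y - x); last by rewrite -E; ring.
have hd w : w \in `]x, y[ -> is_derive w 1 h (n%:R ^ k).
  by rewrite in_itv /= => w1; apply/aff_derive/hk; lra.
apply: (MVT_lin xy hd).
apply/(continuous_within_itvP _ xy); split.
- by move=> w; rewrite in_itv /= => w1; apply: (@aff_continuous _ _ (n%:R ^ k)); apply: hk; lra.
- exact: hx.
- have /hk/aff_continuous hy : x < y < x + d by rewrite xy.
  exact: cvg_at_left_filter.
Qed.

Lemma raff_cvg h x : raff h x -> h y @[y --> x^'+] --> h x.
Proof.
move=> [k [d d0 H]].
have cv : h x + n%:R ^ k * (y - x) @[y --> x] --> h x + n%:R ^ k * (x - x).
  apply: cvgD; first exact: cvg_cst.
  apply: cvgMr; apply: cvgB; [exact: cvg_id|exact: cvg_cst].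
rewrite subrr mulr0 addr0 in cv.
apply: cvg_trans (cvg_at_right_filter cv).
apply: near_eq_cvg; near=> y; rewrite -H //.
apply/andP; split; near: y; first exact: nbhs_right_ge.
by apply: nbhs_right_lt; rewrite ltrDl.
Unshelve. all: by end_near. Qed.

Lemma raff_comp g h x : raff h x -> raff g (h x) -> raff (g \o h) x.
Proof.
move=> [k [d d0 hk]] [l [e e0 gl]]; exists (l + k).
exists (Num.min d (e / n%:R ^ k)); first by rewrite lt_min d0 divr_gt0.
move=> y /andP[xy]; rewrite -ltrBlDl lt_min ltr_pdivlMr// => /andP[y1 y2].
have hy : h y = h x + n%:R ^ k * (y - x) by apply: hk; rewrite xy -ltrBlDl.
rewrite /= hy gl; first by rewrite expfzDr ?gt_eqF//; ring.
rewrite lerDl ltrD2l mulr_ge0 ?subr_ge0 ?(ltW (nX_gt0 _))//=.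
by rewrite mulrC.
Qed.

Lemma raff_inv g h x : cancel h g -> raff h x -> raff g (h x).
Proof.
move=> hK [k [d d0 hk]]; exists (- k), (n%:R ^ k * d); first by rewrite mulr_gt0.
move=> w /andP[xw]; rewrite -ltrBlDl => wd.
have kV : n%:R ^ k * n%:R ^ (- k) = 1 :> R.
  by rewrite -expfzDr ?gt_eqF// subrr expr0z.
have hy : h (x + n%:R ^ (- k) * (w - h x)) = w.
  rewrite hk; first by rewrite addrAC subrr add0r mulrA kV mul1r addrC subrK.
  rewrite lerDl mulr_ge0 ?subr_ge0 ?(ltW (nX_gt0 _))//= ltrD2l.
  by rewrite -(ltr_pM2l (nX_gt0 k)) mulrA kV mul1r.
by rewrite -[in LHS]hy !hK.
Qed.

Lemma aff_comp g h x (c e : R) : aff h x c -> aff g (h x) e ->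
  aff (g \o h) x (e * c).
Proof.
move=> [d d0 hd] [d' d'0 gd].
have c1 : 0 < 1 + `|c| by rewrite ltr_pwDl.
exists (Num.min d (d' / (1 + `|c|))); first by rewrite lt_min d0 divr_gt0.
move=> y; rewrite lt_min ltr_pdivlMr// => /andP[y1 y2].
rewrite /= hd // gd; first by ring.
rewrite addrAC subrr add0r normrM; apply: le_lt_trans y2.
by rewrite mulrC ler_wpM2l// lerDr.
Qed.

Lemma aff_inv g h x (c : R) : cancel h g -> 0 < c -> aff h x c ->
  aff g (h x) c^-1.
Proof.
move=> hK c0 [d d0 hd]; exists (c * d); first by rewrite mulr_gt0.
move=> w wd.
have hy : h (x + c^-1 * (w - h x)) = w.
  rewrite hd; first by rewrite addrAC subrr add0r mulrA divff ?gt_eqF// mul1r addrC subrK.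
  rewrite addrAC subrr add0r normrM gtr0_norm ?invr_gt0//.
  by rewrite mulrC ltr_pdivrMr// mulrC.
by rewrite -[in LHS]hy !hK.
Qed.

Lemma reg_comp g h x : reg h x -> reg g (h x) -> reg (g \o h) x.
Proof.
move=> [k hk] [l gl]; exists (l + k); rewrite expfzDr ?gt_eqF//.
exact: aff_comp.
Qed.

Lemma reg_inv g h x : cancel h g -> reg h x -> reg g (h x).
Proof.
move=> hK [k hk]; exists (- k); rewrite -invr_expz.
exact: aff_inv.
Qed.

Lemma nadic_PL_intro h (S : set R) : finite_set S ->
  (forall x, 0 < x < r%:R -> S x -> nadic x) ->
  (forall x, 0 < x < r%:R -> ~ S x -> reg h x) -> nadic_PL h.
Proof.
move=> fS SZ Sr.
have sub : singularities h `<=` S.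
  move=> x [xr hx]; apply: contrapT => /(Sr _ xr)[k /affP hk]; apply: hx.
  by exists (n%:R ^ k).
split; first exact: sub_finite_set fS.
  by move=> x hx; apply: SZ (sub _ hx); case: hx.
move=> x xr hx.
have [c /affP hc] : locally_affine h x by apply: contrapT => ?; apply: hx.
have [e e0 he] := aff_near hc.
have xm : x < Num.min (x + e) r%:R by rewrite lt_min ltrDl e0; case/andP: xr.
have [d d0 [db H]] := finite_gap fS xm.
move: db; rewrite le_min => /andP[d1 d2].
have [] := Sr (x + d / 2); [lra|by apply: H; lra|move=> k hk; exists k].
have hy : aff h (x + d / 2) c.
  by apply: he; rewrite addrAC subrr add0r gtr0_norm; lra.
rewrite derive1E; have [_ ->] := aff_derive hc.
by have [_ <-] := aff_derive hy; have [_ ->] := aff_derive hk.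
Qed.

Lemma nadic_PL_comp g h : nadic_PL g -> nadic_PL h -> injective h ->
  (forall x, 0 < x < r%:R -> 0 <= h x < r%:R) ->
  (forall x, 0 < x < r%:R -> nadic (h x) -> nadic x) ->
  nadic_PL (g \o h).
Proof.
move=> gPL hPL hI hr hZ; have [gf gZ _] := gPL; have [hf hZ' _] := hPL.
apply: (@nadic_PL_intro _ (singularities h `|`
    h @^-1` (singularities g `|` [set 0]))).
- rewrite finite_setU; split=> //; apply: finite_preimage.
    by move=> x y _ _; exact: hI.
  by rewrite finite_setU; split=> //; exact: finite_set1.
- move=> x xr [/hZ'//|[/gZ|/= hx]]; apply: hZ => //.
  by rewrite hx; exact: nadic0.
- move=> x xr /not_orP[xh /not_orP[xg x0]].
  apply: reg_comp; first exact: nadic_PL_reg.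
  have /andP[h0 h1] := hr _ xr.
  by apply: nadic_PL_reg => //; rewrite h1 andbT lt_neqAle h0 andbT eq_sym; apply/eqP.
Qed.

Lemma nadic_PL_inv g h : nadic_PL h -> cancel h g -> cancel g h ->
  (forall y, 0 < y < r%:R -> 0 <= g y < r%:R) ->
  (forall x, 0 <= x < r%:R -> nadic x -> nadic (h x)) ->
  nadic_PL g.
Proof.
move=> hPL hK gK gr hZ; have [hf hZ' _] := hPL.
apply: (@nadic_PL_intro _ (h @` (singularities h `|` [set 0]))).
- by apply: finite_image; rewrite finite_setU; split => //; exact: finite_set1.
- move=> y /gr gy [x xS E]; move: gy; rewrite -E hK => xr; apply: hZ => //.
  by case: xS => [/hZ'//|->]; exact: nadic0.
- move=> y yr yS; rewrite -[y]gK; apply: reg_inv => //.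
  have /andP[g0 g1] := gr _ yr.
  apply: nadic_PL_reg => //.
    rewrite g1 andbT lt_neqAle g0 andbT eq_sym; apply/eqP => gy; apply: yS.
    by exists (g y) => //; right.
  by move=> gy; apply: yS; exists (g y) => //; left.
Qed.

Lemma nadic_PL_id : nadic_PL id.
Proof.
apply: (@nadic_PL_intro _ set0) => // x _ _; exists 0, 1 => // y _.
by rewrite expr0z mul1r addrC subrK.
Qed.

Lemma fix_inj h (i : interval R) : set_bij [set` i] [set` i] h ->
  (forall x, x \notin i -> h x = x) -> injective h.
Proof.
move=> [hD hI _] hid x y.
have [xD|xD] := boolP (x \in i); have [yD|yD] := boolP (y \in i).
- by apply: hI; rewrite inE.
- by rewrite (hid y)// => E; case/negP: yD; rewrite -E; exact: hD.
- by rewrite (hid x)// => E; case/negP: xD; rewrite E; exact: hD.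
- by rewrite !hid.
Qed.

Lemma fix_bij h (i : interval R) : set_bij [set` i] [set` i] h ->
  (forall x, x \notin i -> h x = x) ->
  exists g, [/\ cancel h g, cancel g h, set_bij [set` i] [set` i] g &
    forall x, x \notin i -> g x = x].
Proof.
move=> hb hid; have hI := fix_inj hb hid; have [hD _ hS] := hb.
have /choice[g gK] : forall y, exists x, h x = y /\ (y \in i -> x \in i).
  move=> y; have [/hS[x Dx <-]|yD] := boolP (y \in i); first by exists x.
  by exists y; rewrite hid.
have gK1 y : h (g y) = y by case: (gK y).
have hK : cancel h g by move=> x; apply: hI.
exists g; split => //.
  split.
  - by move=> y; case: (gK y).
  - by move=> x y _ _ /(congr1 h); rewrite !gK1.
  - by move=> x Dx; exists (h x); [exact: hD|exact: hK].
by move=> x xD; apply: hI; rewrite gK1 hid.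
Qed.

Lemma set_bij_id (D : set R) : set_bij D D id.
Proof. by split=> // x Dx; exists x. Qed.

Lemma set_bij_comp2 (D : set R) g h : set_bij D D g -> set_bij D D h ->
  set_bij D D (g \o h).
Proof.
move=> [gD gI gS] [hD hI hS]; split.
- by move=> x /hD /gD.
- move=> x y xD yD /= /gI gh; apply: hI => //; apply: gh;
    by rewrite inE; apply: hD; rewrite -inE.
- by move=> z /gS[y /hS[x Dx <-] <-]; exists x.
Qed.

Fact G_set_id : G_set id.
Proof.
split=> //; [exact: set_bij_id| |exact: nadic_PL_id|by rewrite image_id].
by move=> x _; exact: cvg_at_right_filter.
Qed.

Lemma G_nadic h x : G_set h -> x \in `[0, r%:R[ -> nadic (h x) <-> nadic x.
Proof.
move=> [hb _ _ hZ hid] xr; split=> [hx|xZ].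
  have [hD _ _] := hb.
  have : (h @` (nadic `&` `[0, r%:R[)) (h x) by rewrite hZ; split=> //; exact: hD.
  by move=> [y [yZ _] /(fix_inj hb hid) <-].
have : (h @` (nadic `&` `[0, r%:R[)) (h x) by exists x.
by rewrite hZ => -[].
Qed.

Lemma G_raff h x : G_set h -> x \in `[0, r%:R[ -> raff h x.
Proof.
move=> [_ hc hPL _ _] xr; apply: PL_raff; [exact: hPL| |exact: hc].
by move: xr; rewrite /= in_itv.
Qed.

Fact G_set_comp g h : G_set g -> G_set h -> G_set (g \o h).
Proof.
move=> Gg Gh; have [gb gc gPL gZ gid] := Gg; have [hb hc hPL hZ hid] := Gh.
have [hD _ _] := hb.
have oo x : 0 < x < r%:R -> x \in `[0, r%:R[ by rewrite /= in_itv/=; lra.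
split.
- exact: set_bij_comp2.
- move=> x xr; apply: raff_cvg; apply: raff_comp; first exact: G_raff.
  by apply: G_raff => //; exact: hD.
- apply: nadic_PL_comp => //.
  + exact: fix_inj hid.
  + by move=> x /oo /hD; rewrite /= in_itv.
  + by move=> x /oo /(G_nadic Gh) [].
- by rewrite -image_comp hZ gZ.
- by move=> x xr; rewrite /= hid// gid.
Qed.

Fact G_set_inv h : G_set h -> exists g, [/\ G_set g, cancel h g & cancel g h].
Proof.
move=> Gh; have [hb hc hPL hZ hid] := Gh.
have [g [hK gK gb gid]] := fix_bij hb hid; exists g; split=> //.
have [gD _ _] := gb.
split => //.
- move=> y yr; rewrite -[y]gK; apply: raff_cvg; apply: raff_inv => //.
  by apply: G_raff => //; exact: gD.
- apply: (nadic_PL_inv hPL) => //.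
  + move=> y yr; have /gD : y \in `[0, r%:R[ by rewrite /= in_itv/=; lra.
    by rewrite /= in_itv.
  + by move=> x xr; apply: (G_nadic Gh _).2; rewrite /= in_itv.
- by rewrite -{1}hZ image_comp (_ : g \o h = id) ?image_id//; exact/funext.
Qed.

Definition G_perm : permgroup R := PermGroup G_set_id G_set_comp G_set_inv.

Lemma homo_cont h : set_bij `[0, r%:R] `[0, r%:R] h ->
  {in `[0, r%:R] &, {homo h : x y / x < y}} ->
  [/\ h 0 = 0, h r%:R = r%:R & {within `[0, r%:R], continuous h}].
Proof.
move=> [hD hI hS] hm.
have c0 : (0 : R) \in `[0, r%:R] by rewrite in_itv/= lexx ler0n.
have c1 : (r%:R : R) \in `[0, r%:R] by rewrite in_itv/= lexx ler0n.
have hm' : {in `[0, r%:R] &, {mono h : x y / x <= y}} by exact: le_mono_in.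
have h0 : h 0 = 0.
  have [x xr hx] := hS _ c0; apply/eqP; rewrite eq_le.
  have := hD _ c0; rewrite /= in_itv/= => /andP[-> _]; rewrite andbT -{2}hx.
  by rewrite hm'//; move: xr; rewrite /= in_itv/= => /andP[].
have h1 : h r%:R = r%:R.
  have [x xr hx] := hS _ c1; apply/eqP; rewrite eq_le.
  have := hD _ c1; rewrite /= in_itv/= => /andP[_ ->] /=; rewrite -{1}hx.
  by rewrite hm'//; move: xr; rewrite /= in_itv/= => /andP[].
split=> //; apply: segment_inc_surj_continuous => //.
by rewrite h0 h1.
Qed.

Lemma F_oo h x : F_set h -> 0 < x < r%:R -> 0 < h x < r%:R.
Proof.
move=> [hb _ hm _ _] /andP[x0 x1]; have [h0 h1 _] := homo_cont hb hm.
have r0 : 0 < r%:R :> R by lra.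
rewrite -{1}h0 -{1}h1.
by apply/andP; split; apply: hm => //; rewrite in_itv/=; lra.
Qed.

Lemma F_nadic_aux h (s : seq R) (a b : R) : F_set h ->
  0 <= a -> a < b -> b <= r%:R ->
  (forall y, a < y < b -> singularities h y -> y \in s) ->
  nadic a -> nadic (h a) -> nadic (h b) <-> nadic b.
Proof.
move=> Fh; have [hb hc hm hPL _] := Fh; have [_ hZ _] := hPL.
elim: s a b => [|p s IH] a b a0 ab br hs aZ haZ.
  have hcab : {within `[a, b], continuous h}.
    by apply: continuous_subspaceW hc; apply: subset_itv; rewrite bnd_simp.
  have [|k E] := reg_MVT ab hcab.
    move=> y yab; apply: nadic_PL_reg => //; first by lra.
    by move=> /(hs _ yab).
  have lab : h a <= h b.
    by rewrite -subr_ge0 E mulr_ge0 ?subr_ge0 ?ltW.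
  split=> H.
    have /nadicMV : nadic (n%:R ^ k * (b - a)) by rewrite -E; exact: nadicB.
    by move=> /(nadicD aZ); rewrite addrC subrK.
  have -> : h b = n%:R ^ k * (b - a) + h a by rewrite -E subrK.
  by apply: nadicD => //; apply: nadicM; apply: nadicB => //; exact: ltW.
have [[pab ps]|np] := pselect (a < p < b /\ singularities h p); last first.
  have hs' y : a < y < b -> singularities h y -> y \in s.
    move=> yab ys; have := hs _ yab ys.
    by rewrite in_cons => /orP[/eqP yp|//]; case: np; rewrite -yp.
  exact: (IH a b a0 ab br hs' aZ haZ).
have pZ := hZ _ ps.
have hs1 y : a < y < p -> singularities h y -> y \in s.
  move=> yap ys; have : y \in p :: s by apply: hs => //; lra.
  by rewrite in_cons => /orP[/eqP yp|//]; move: yap; rewrite yp; lra.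
have hs2 y : p < y < b -> singularities h y -> y \in s.
  move=> yap ys; have : y \in p :: s by apply: hs => //; lra.
  by rewrite in_cons => /orP[/eqP yp|//]; move: yap; rewrite yp; lra.
have [ap pb] : a < p /\ p < b by case/andP: pab.
have p0 : 0 <= p by lra.
have pr : p <= r%:R by lra.
have hpZ : nadic (h p) by exact: (IH a p a0 ap pr hs1 aZ haZ).2.
exact: (IH p b p0 pb br hs2 pZ hpZ).
Qed.

Lemma F_nadic h x : F_set h -> 0 <= x <= r%:R -> nadic (h x) <-> nadic x.
Proof.
move=> Fh /andP[x0 xr]; have [hb hc hm [/finite_seqP[s sE] _ _] _] := Fh.
have [h0 _ _] := homo_cont hb hm.
move: x0; rewrite le_eqVlt => /orP[/eqP<-|x0]; first by rewrite h0.
apply: (@F_nadic_aux h s 0 x) => //; last first.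
- by rewrite h0; exact: nadic0.
- exact: nadic0.
by move=> y _; rewrite sE.
Qed.

Fact F_set_id : F_set id.
Proof.
have m : {in `[0, r%:R] &, {homo (@id R) : x y / x < y}} by [].
have [_ _ c] := homo_cont (set_bij_id _) m.
by split; [exact: set_bij_id|exact: c|exact: m|exact: nadic_PL_id|].
Qed.

Fact F_set_comp g h : F_set g -> F_set h -> F_set (g \o h).
Proof.
move=> Fg Fh; have [gb gc gm gPL gid] := Fg; have [hb hc hm hPL hid] := Fh.
have [hD _ _] := hb.
have ghb := set_bij_comp2 gb hb.
have ghm : {in `[0, r%:R] &, {homo g \o h : x y / x < y}}.
  by move=> x y xr yr xy; apply: gm; [exact: hD|exact: hD|exact: hm].
split=> //; first by have [] := homo_cont ghb ghm.
  apply: nadic_PL_comp => //.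
  - exact: fix_inj hid.
  - by move=> x /(F_oo Fh); lra.
  - by move=> x xr; apply: (F_nadic Fh _).1; lra.
by move=> x xr; rewrite /= hid// gid.
Qed.

Fact F_set_inv h : F_set h -> exists g, [/\ F_set g, cancel h g & cancel g h].
Proof.
move=> Fh; have [hb hc hm hPL hid] := Fh.
have [g [hK gK gb gid]] := fix_bij hb hid; exists g; split=> //.
have [gD _ _] := gb.
have hm' : {in `[0, r%:R] &, {mono h : x y / x < y}}.
  by apply: leW_mono_in; exact: le_mono_in.
have gm : {in `[0, r%:R] &, {homo g : x y / x < y}}.
  by move=> x y xr yr xy; rewrite -hm' ?gK//; exact: gD.
have [g0 g1 gc] := homo_cont gb gm.
split=> //; apply: (nadic_PL_inv hPL) => //.
  move=> y /andP[y0 yr]; rewrite -{1}g0 -{1}g1.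
  have r0 : 0 < r%:R :> R by lra.
  by rewrite (ltW (gm _ _ _ _ y0)) ?gm//; rewrite in_itv/=; lra.
by move=> x xr; apply: (F_nadic Fh _).2; lra.
Qed.

Definition F_perm : permgroup R := PermGroup F_set_id F_set_comp F_set_inv.

Definition F_group : groupType := pg_type F_perm.
Definition G_group : groupType := pg_type G_perm.

End HigmanThompson.

Inductive HT_family := HT_F | HT_G.

Definition HT_group (fam : HT_family) (R : realType) (n r : nat)
    (n_gt0 : (0 < n)%N) : groupType :=
  match fam with
  | HT_F => F_group R r n_gt0
  | HT_G => G_group R r n_gt0
  end.

Definition normal_subgroup (G : groupType) (N : set G) :=
  [/\ N 1%g,
      forall x y, N x -> N y -> N (x * y)%g,
      forall x, N x -> N (x^-1)%g &
      forall x y, N x -> N (x ^ y)%g].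

Definition simple_group (G : groupType) :=
  (exists x : G, x <> 1%g) /\
  forall N : set G, normal_subgroup N -> N = [set 1%g] \/ N = setT.

Section Actions.
Context d (X : measurableType d) (R : realType) (mu : probability X R).
Variables (G : groupType) (act : G -> X -> X).

Definition mp_action :=
  [/\ forall x, act 1%g x = x,
      forall g h x, act (g * h)%g x = act g (act h x),
      forall g, measurable_fun setT (act g) &
      forall g A, measurable A -> mu (act g @^-1` A) = mu A].

Definition ergodic_action :=
  forall A, measurable A -> (forall g, act g @^-1` A = A) ->
    mu A = 0%E \/ mu A = 1%E.

Definition trivial_action := forall g, {ae mu, forall x, act g x = x}.

(* This set is measurable if X is a standard Borel space, but need not be so
   in an arbitrary measurable space. *)
Definition fix_set (g : G) : set X := [set x | act g x = x].

Definition essentially_free_action :=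
  forall g, g <> 1%g -> mu (fix_set g) = 0%E.

End Actions.

(* Main.v *)
Require Import Defs.
From mathcomp Require Import all_boot all_order all_algebra.
From mathcomp Require Import all_classical all_reals all_analysis.
From mathcomp Require Import perm ring lra zify.

(** Two mechanisms prove essential freeness.

    In an abelian group every set Fix(g) is invariant, hence null or conull by
    ergodicity, and a conull one puts g into the kernel of the action, which is
    a normal subgroup and so everything (abelian_essentially_free).  A simple
    group with a proper normal subgroup that contains all commutators is abelian
    (commutator_quotient_abelian).  This disposes of F_{n,r} for n >= 2, through
    the elements that are the identity near 0, and of G_{1,r} for r >= 2, which
    permutes the r unit intervals, through the even permutations.  The groups
    F_{1,r} and G_{1,1} are trivial, hence not simple.

    The group G = G_{n,r} with n >= 2 is flexible: it moves finite unions of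
    n-adic intervals (regions) around so freely that any finite family of
    disjoint regions, not covering everything, can be moved by one element in
    every way in which its members can be moved separately (glue_family).
    Suppose that mu(Fix(g)) > 0 for some g <> 1.  Let q map a region U into
    itself, and let W (germ_set) be the set of the points x that are fixed by
    some element of G which agrees with q on U.  The translate t W depends only
    on the restriction of t to U.  So, when the sets t_i U are disjoint, the
    measure of the intersection of t_1 W, ..., t_N W depends only on N
    (measure_copies).  This number stays above a positive constant
    (copies_lower_bound): by the pigeonhole principle, conjugates of Fix(g) by
    two elements h, h' supported in a region V with gV disjoint from V meet in
    a set of measure bounded below; a point of the intersection is, up to
    translation, fixed by the commutator of g and w = h^-1 * h', which on V
    is w^-1; and h and h' can be chosen so that w^-1 acts as q does on N
    copies of U.  Passing to infinitely
    many copies, the intersection of the t_i W has positive measure, and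
    adding one more copy u W to an intersection does not change its measure.
    Hence almost all of this intersection lies in every translate of W, and the
    intersection of all translates, which is invariant, is conull by ergodicity
    (germ_set_full).  Thus W itself is conull.

    Finally, cut [0, r[ into regions U, Z1, Z2, and let q and k be supported in
    U and not commute.  Almost every x is fixed by an element h that agrees with
    q on U and is the identity on Z2, and by an element l that agrees with k on U
    and is the identity on Z1.  The commutator of h and l is that of q and k,
    which therefore acts trivially almost everywhere.  By simplicity the whole
    action is trivial. *)

Set Implicit Arguments.
Unset Strict Implicit.
Unset Printing Implicit Defensive.
Import Order.TTheory GRing.Theory Num.Theory.
Import numFieldNormedType.Exports.
Local Open Scope classical_set_scope.
Local Open Scope ring_scope.

(** * Flexible actions *)

Section Flexible.
Local Open Scope group_scope.
Variables (G : groupType) (T : Type) (ev : G -> T -> T).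
Variables (D : set T) (region : set (set T)).

(** This collects what the measure-theoretic argument uses of a
    Higman-Thompson group acting on D = [0, r[.  The members of region are the
    clopen sets of a topology without isolated points; flex_compress is the
    compressibility of proper clopen sets, and flex_swap is the closure of the
    group under cutting and pasting along clopen sets.  T may
    be larger than D: for G_{n,r} it is the whole line. *)
Record flexible := Flexible {
  flex1 : forall x, ev 1 x = x ;
  flexM : forall g h x, ev (g * h) x = ev g (ev h x) ;
  flexD : forall g x, D x -> D (ev g x) ;
  flex_full : region D ;
  flex_sub : forall P, region P -> P `<=` D ;
  flexU : forall P Q, region P -> region Q -> region (P `|` Q) ;
  flexB : forall P Q, region P -> region Q -> region (P `\` Q) ;
  flex_image : forall g P, region P -> region (ev g @` P) ;
  flex_split : forall P, region P -> P !=set0 ->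
    exists Q, [/\ region Q, Q `<=` P, Q !=set0 & P `\` Q !=set0] ;
  flex_compress : forall P Q, region P -> region Q -> P !=set0 ->
    D `\` Q !=set0 -> exists g, ev g @` Q `<=` P ;
  flex_swap : forall g Q, region Q -> (forall x, Q x -> ~ Q (ev g x)) ->
    exists s, (forall x, Q x -> ev s x = ev g x) /\
      (forall x, ~ Q x -> ~ (ev g @` Q) x -> ev s x = x) ;
  flex_displace : forall g, g <> 1 ->
    exists P, [/\ region P, P !=set0 & forall x, P x -> ~ P (ev g x)] }.

Hypothesis fl : flexible.

Lemma evK g : cancel (ev g) (ev g^-1).
Proof. by move=> x; rewrite -(flexM fl) mulVg (flex1 fl). Qed.

Lemma evVK g : cancel (ev g^-1) (ev g).
Proof. by move=> x; rewrite -(flexM fl) mulgV (flex1 fl). Qed.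

Lemma ev_inj g : injective (ev g).
Proof. exact: can_inj (evK g). Qed.

Lemma region0 : region set0.
Proof. by rewrite -(setDv D); apply: (flexB fl); exact: (flex_full fl). Qed.

Lemma region_bigcup N (P : nat -> set T) :
  (forall i, (i < N)%N -> region (P i)) -> region (\bigcup_(i < N) P i).
Proof.
elim: N => [|N IH] rP.
  rewrite (_ : \bigcup_(_ in _) _ = set0); first exact: region0.
  by apply/seteqP; split => // x [].
rewrite (_ : \bigcup_(i < N.+1) _ = \bigcup_(i < N) P i `|` P N).
  apply: (flexU fl); last exact: rP.
  by apply: IH => i iN; apply: rP; lia.
apply/seteqP; split => [x [i /= iN Px]|x [[i /= iN Px]|Px]].
- have [iE|iN'] := eqVneq i N; first by right; rewrite -iE.
  by left; exists i => //=; lia.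
- by exists i => //=; lia.
- by exists N => /=.
Qed.

Lemma ev_ext g h : (forall x, D x -> ev g x = ev h x) -> g = h.
Proof.
move=> gh; apply: contrapT => ngh.
have [|P [rP [x Px] PP]] := flex_displace fl (g := h^-1 * g).
  by move=> /(congr1 (fun k => h * k)); rewrite mulgA mulgV mul1g mulg1.
apply: (PP x Px); rewrite (flexM fl) gh ?evK //.
exact: (flex_sub fl rP).
Qed.

(** Exchanging Q with its image does not disturb a set that avoids both. *)
Lemma glue_disjoint P Q f : region Q ->
  (forall x, P x -> ~ Q x) -> (forall x, Q x -> ~ P (ev f x)) ->
  (forall x, Q x -> ~ Q (ev f x)) ->
  exists u, (forall x, P x -> ev u x = x) /\ (forall x, Q x -> ev u x = ev f x).
Proof.
move=> rQ PQ PfQ QfQ; have [s [s1 s2]] := flex_swap fl rQ QfQ.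
exists s; split=> // x Px; apply: s2; first exact: PQ.
by move=> [y Qy yx]; apply: (PfQ _ Qy); rewrite yx.
Qed.

(** When Q meets its image, a single exchange does not realize f on Q.  Two
    exchanges do: compress Q into a region E that is free, and move it from
    there to the image. *)
Lemma glue_via P Q E f : region Q -> region E -> E !=set0 ->
  D `\` Q !=set0 ->
  (forall x, P x -> ~ Q x) -> (forall x, Q x -> ~ P (ev f x)) ->
  (forall x, E x -> ~ P x) -> (forall x, E x -> ~ Q x) ->
  (forall x, Q x -> ~ E (ev f x)) ->
  exists u, (forall x, P x -> ev u x = x) /\ (forall x, Q x -> ev u x = ev f x).
Proof.
move=> rQ rE E0 DQ PQ PfQ EP EQ EfQ.
have [t tQ] := flex_compress fl rE rQ E0 DQ.
have tQE x : Q x -> E (ev t x) by move=> Qx; apply: tQ; exists x.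
have [u1 [u1P u1Q]] : exists u, (forall x, P x -> ev u x = x) /\
    (forall x, Q x -> ev u x = ev t x).
  by apply: glue_disjoint => // x Qx => [/(EP _ (tQE _ Qx))//|/(EQ _ (tQE _ Qx))].
have [u2 [u2P u2Q]] : exists u, (forall x, P x -> ev u x = x) /\
    (forall x, (ev t @` Q) x -> ev u x = ev (f * t^-1) x).
  apply: glue_disjoint; first exact: (flex_image fl).
  - by move=> x Px [y Qy yx]; apply: (EP x) => //; rewrite -yx; exact: tQE.
  - by move=> _ [y Qy <-]; rewrite (flexM fl) evK; exact: PfQ.
  - by move=> _ [y Qy <-]; rewrite (flexM fl) evK => /tQ; exact: EfQ.
exists (u2 * u1); split=> x Px; rewrite (flexM fl).
  by rewrite u1P// u2P.
by rewrite u1Q// u2Q ?(flexM fl) ?evK//; exists x.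
Qed.

(** Free room before the move and free room after it suffice, even if P, Q and
    the image of Q together cover D: then the two free regions are disjoint and
    Q travels through both of them. *)
Lemma glue2 P Q f : region P -> region Q ->
  (forall x, P x -> ~ Q x) -> (forall x, Q x -> ~ P (ev f x)) ->
  D `\` (P `|` Q) !=set0 -> D `\` (P `|` ev f @` Q) !=set0 ->
  exists u, (forall x, P x -> ev u x = x) /\ (forall x, Q x -> ev u x = ev f x).
Proof.
move=> rP rQ PQ PfQ E1 E2.
have rfQ := flex_image fl f rQ.
have rE1 : region (D `\` (P `|` Q)).
  by apply: (flexB fl); [exact: flex_full|exact: (flexU fl)].
have rE2 : region (D `\` (P `|` ev f @` Q)).
  by apply: (flexB fl); [exact: flex_full|exact: (flexU fl)].
have DQ : D `\` Q !=set0 by have [x [Dx /not_orP[_ Qx]]] := E1; exists x.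
have [[x [Dx /not_orP[/not_orP[nP nQ] nfQ]]]|noE] :=
    pselect (D `\` ((P `|` Q) `|` ev f @` Q) !=set0).
  apply: (@glue_via P Q (D `\` ((P `|` Q) `|` ev f @` Q))) => //.
  - by apply: (flexB fl) => //; [exact: flex_full|do 2 apply: (flexU fl) => //].
  - by exists x; split=> //; move=> [[]|].
  - by move=> y [_ /not_orP[/not_orP[]]].
  - by move=> y [_ /not_orP[/not_orP[]]].
  - by move=> y Qy [_ /not_orP[_]]; apply; exists y.
have [t tQ] := flex_compress fl rE1 rQ E1 DQ.
have tQE x : Q x -> (D `\` (P `|` Q)) (ev t x) by move=> Qx; apply: tQ; exists x.
have [u1 [u1P u1Q]] : exists u, (forall x, P x -> ev u x = x) /\
    (forall x, Q x -> ev u x = ev t x).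
  by apply: glue_disjoint => // x /tQE[_ /not_orP[]].
(* No point is free both before and after, so the second free region avoids
   the place where Q has been parked. *)
have E12 x : (D `\` (P `|` ev f @` Q)) x -> ~ (ev t @` Q) x.
  move=> [Dx /not_orP[nP nfQ]] [y /tQE[_ /not_orP[n1 n2]] yx].
  by apply: noE; exists x; split=> // -[[|]|] //; rewrite -yx.
have [u2 [u2P u2Q]] : exists u, (forall x, P x -> ev u x = x) /\
    (forall x, (ev t @` Q) x -> ev u x = ev (f * t^-1) x).
  apply: (@glue_via _ _ (D `\` (P `|` ev f @` Q))) => //.
  - exact: (flex_image fl).
  - by have [x Ex] := E2; exists x; split; [case: Ex|exact: E12].
  - by move=> x Px [y /tQE[_ /not_orP[nP _]] yx]; apply: nP; rewrite yx.
  - by move=> _ [y Qy <-]; rewrite (flexM fl) evK; exact: PfQ.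
  - by move=> x [_ /not_orP[]].
  - by move=> _ [y Qy <-]; rewrite (flexM fl) evK => -[_ /not_orP[_]]; apply; exists y.
exists (u2 * u1); split=> x Px; rewrite (flexM fl).
  by rewrite u1P// u2P.
by rewrite u1Q// u2Q ?(flexM fl) ?evK//; exists x.
Qed.

(** Elements can be prescribed independently on finitely many disjoint regions,
    as long as the images are disjoint and neither the regions nor their images
    cover D.  The region P0, which is kept fixed pointwise, serves to confine
    the support of the element. *)
Lemma glue_family N (P0 : set T) (P : nat -> set T) (f : nat -> G) : region P0 ->
  (forall i, (i < N)%N -> region (P i)) ->
  (forall i x, (i < N)%N -> P i x -> ~ P0 x /\ ~ P0 (ev (f i) x)) ->
  (forall i j x, (i < N)%N -> (j < N)%N -> P i x -> P j x -> i = j) ->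
  (forall i j x y, (i < N)%N -> (j < N)%N -> P i x -> P j y ->
     ev (f i) x = ev (f j) y -> i = j) ->
  (exists x, [/\ D x, ~ P0 x & forall i, (i < N)%N -> ~ P i x]) ->
  (exists x, [/\ D x, ~ P0 x & forall i, (i < N)%N -> ~ (ev (f i) @` P i) x]) ->
  exists u, (forall x, P0 x -> ev u x = x) /\
    forall i x, (i < N)%N -> P i x -> ev u x = ev (f i) x.
Proof.
move=> rP0; elim: N => [|N IH] rP P0P PP fPP [x0 [Dx0 n0 nx0]] [y0 [Dy0 m0 ny0]].
  by exists 1; split=> // x _; exact: (flex1 fl).
have [||||||u [u0 uP]] := IH.
- by move=> i iN; apply: rP; lia.
- by move=> i x iN; apply: P0P; lia.
- by move=> i j x iN jN; apply: PP; lia.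
- by move=> i j x y iN jN; apply: fPP; lia.
- by exists x0; split=> // i iN; apply: nx0; lia.
- by exists y0; split=> // i iN; apply: ny0; lia.
(* With u found for the first N regions, it remains to correct u on the last
   one, without changing it on the union B of the others. *)
pose B := P0 `|` \bigcup_(i < N) P i.
have rB : region B.
  by apply: (flexU fl) => //; apply: region_bigcup => i iN; apply: rP; lia.
have uB x : B x -> P0 (ev u x) \/ exists2 i, (i < N)%N & (ev (f i) @` P i) (ev u x).
  move=> [Px|[i /= iN Pix]]; first by left; rewrite u0.
  by right; exists i => //; exists x => //; rewrite (uP i).
have [v [vB vN]] : exists v, (forall x, B x -> ev v x = x) /\
    (forall x, P N x -> ev v x = ev (u^-1 * f N) x).
  apply: glue2 => //.
  - exact: rP.
  - move=> x [Px PNx|[i /= iN Pix PNx]]; first by case: (P0P N x).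
    by have : i = N by [apply: PP Pix PNx; lia]; lia.
  - move=> x PNx; rewrite (flexM fl) => /uB; rewrite evVK => -[|[i iN [y Piy yx]]].
      by have [_] := P0P N x (ltnSn N) PNx.
    by have : i = N by [apply: fPP Piy PNx yx; lia]; lia.
  - exists x0; split=> // -[[//|[i /= iN]]|]; last exact: nx0.
    by apply: nx0; lia.
  - exists (ev u^-1 y0); split; first exact: (flexD fl).
    move=> [/uB|[z PNz]].
      by rewrite evVK => -[//|[i iN]]; apply: ny0; lia.
    by rewrite (flexM fl) => /(ev_inj) zy; apply: (ny0 N) => //; exists z.
exists (u * v); split=> [x Px|i x iN Pix]; rewrite (flexM fl).
  by rewrite vB ?u0//; left.
have [iN'|iN'] := ltnP i N; first by rewrite vB ?(uP i)//; right; exists i.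
have iE : i = N by lia.
by rewrite iE in Pix *; rewrite vN// (flexM fl) evVK.
Qed.

Lemma disjoint_regions e : region e -> e !=set0 ->
  exists E : nat -> set T, [/\ forall i, region (E i), forall i, E i !=set0,
    forall i, E i `<=` e & forall i j x, E i x -> E j x -> i = j].
Proof.
move=> re e0.
have /choice[sp spP] : forall P, exists Q, region P -> P !=set0 ->
    [/\ region Q, Q `<=` P, Q !=set0 & P `\` Q !=set0].
  move=> P; have [[rP P0]|nP] := pselect (region P /\ P !=set0).
    by have [Q QP] := flex_split fl rP P0; exists Q.
  by exists P => rP P0; case: nP.
pose F i := iter i (fun P => P `\` sp P) e.
have FP i : region (F i) /\ F i !=set0.
  elim: i => [//|i [rF F0]]; have [? ? ? ?] := spP _ rF F0.
  by split=> //; exact: (flexB fl).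
have sF i : F i.+1 `<=` F i by move=> x [].
have sF' i j : (i <= j)%N -> F j `<=` F i.
  elim: j => [|j IH]; first by rewrite leqn0 => /eqP->.
  rewrite leq_eqVlt => /orP[/eqP -> //|ij]; apply: subset_trans (sF j) _.
  by apply: IH; lia.
have EP i := spP _ (FP i).1 (FP i).2.
have dis i j x : (i < j)%N -> sp (F i) x -> ~ sp (F j) x.
  move=> ij Ex; have [_ s _ _] := EP j => /s /(sF' _ _ ij).
  by move=> [].
exists (fun i => sp (F i)); split=> [i|i|i|i j x Ei Ej].
- by have [] := EP i.
- by have [] := EP i.
- have [_ s _ _] := EP i; apply: subset_trans s _.
  exact: (sF' 0%N i).
- by have [ij|ij|//] := ltngtP i j; [case: (dis _ _ _ ij Ei)|case: (dis _ _ _ ij Ej)].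
Qed.

Lemma disjoint_copies U e : region U -> D `\` U !=set0 ->
  region e -> e !=set0 ->
  exists t : nat -> G, (forall i x, U x -> e (ev (t i) x)) /\
    forall i j x y, U x -> U y -> ev (t i) x = ev (t j) y -> i = j.
Proof.
move=> rU DU re e0; have [E [rE E0 sE dE]] := disjoint_regions re e0.
have /choice[t tP] : forall i, exists g, ev g @` U `<=` E i.
  by move=> i; exact: (flex_compress fl).
exists t; split=> [i x Ux|i j x y Ux Uy xy]; first by apply/(sE i)/tP; exists x.
by apply: (dE i j (ev (t i) x)); [apply/tP; exists x|rewrite xy; apply/tP; exists y].
Qed.

End Flexible.

(** * The kernel of an action up to null sets *)

Section KernelOfAction.
Context d (X : measurableType d) (R : realType) (mu : probability X R).
Variables (G : groupType) (act : G -> X -> X).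
Hypothesis act_mp : mp_action mu act.
Hypothesis mfix : forall g, measurable (fix_set act g).
Local Open Scope group_scope.

Lemma actM g h x : act (g * h) x = act g (act h x).
Proof. by case: act_mp. Qed.

Lemma actK g : cancel (act g) (act g^-1).
Proof. by case: act_mp => a1 aM _ _ x; rewrite -aM mulVg a1. Qed.

Lemma actVK g : cancel (act g^-1) (act g).
Proof. by case: act_mp => a1 aM _ _ x; rewrite -aM mulgV a1. Qed.

Lemma act_fixV g x : act g x = x -> act g^-1 x = x.
Proof. by move=> gx; rewrite -[in LHS]gx actK. Qed.

Lemma measurable_act g A : measurable A -> measurable (act g @^-1` A).
Proof.
move=> mA; case: act_mp => _ _ mact _.
by rewrite -[X in measurable X]setTI; exact: mact.
Qed.

Lemma full_ae A : measurable A -> mu A = 1%E -> \forall x \ae mu, A x.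
Proof.
move=> mA A1; exists (~` A); split; [exact: measurableC| |by []].
by rewrite probability_setC// A1 subee.
Qed.

Lemma ae_act g (P : X -> Prop) :
  (\forall x \ae mu, P x) -> \forall x \ae mu, P (act g x).
Proof.
move=> [B [mB B0 PB]]; exists (act g @^-1` B); split.
- exact: measurable_act.
- by case: act_mp => _ _ _ ->.
- by move=> x /= nP; exact: PB.
Qed.

Definition ae_kernel : set G := [set g | \forall x \ae mu, act g x = x].

Lemma normal_ae_kernel : normal_subgroup ae_kernel.
Proof.
split.
- by apply: aeW => x; case: act_mp.
- move=> g h Kg Kh; apply: filterS2 Kg Kh => x gx hx.
  by rewrite actM hx gx.
- by move=> g; apply: filterS => x; exact: act_fixV.
- move=> g h /(ae_act h); apply: filterS => x ghx.
  by rewrite /conjg !actM ghx actK.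
Qed.

Lemma simple_trivial_action (g : G) : simple_group G -> g <> 1 ->
  (\forall x \ae mu, act g x = x) -> trivial_action mu act.
Proof.
move=> [_ simp] g1 gx h.
have [K1|KT] := simp _ normal_ae_kernel.
  by have : ae_kernel g by []; rewrite K1.
by have : ae_kernel h by rewrite KT.
Qed.

Lemma abelian_essentially_free : simple_group G ->
  (forall g h : G, g * h = h * g) -> ergodic_action mu act ->
  ~ trivial_action mu act -> essentially_free_action mu act.
Proof.
move=> simp cG erg ntriv g g1.
have [h|//|full] := erg _ (mfix g).
  apply/seteqP; split=> x /=.
    by rewrite /fix_set /= -actM cG actM => /(can_inj (actK h)).
  by rewrite /fix_set /= -actM cG actM => ->.
exfalso; apply: ntriv; apply: (simple_trivial_action simp g1).
exact: full_ae full.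
Qed.

Lemma commutator_quotient_abelian (N : set G) : simple_group G ->
  normal_subgroup N -> (forall g h, N (g^-1 * (h^-1 * (g * h)))) -> N <> setT ->
  forall g h : G, g * h = h * g.
Proof.
move=> [_ simp] nN cN NT g h; have [N1|//] := simp _ nN.
have := cN g h; rewrite N1 => /(congr1 (fun k => h * (g * k))) /=.
by rewrite mulg1 !mulgA mulgK mulgV mul1g.
Qed.

End KernelOfAction.

Section Pigeonhole.
Context d (X : measurableType d) (R : realType) (mu : probability X R).

Let P A := fine (mu A).

Let PE A : measurable A -> mu A = (P A)%:E.
Proof. by move=> mA; rewrite fineK// fin_num_measure. Qed.

Let P_le1 A : measurable A -> P A <= 1.
Proof. by move=> mA; rewrite -lee_fin -PE//; exact: probability_le1. Qed.

Let PU A B : measurable A -> measurable B -> P (A `|` B) = P A + P B - P (A `&` B).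
Proof.
move=> mA mB; apply: EFin_inj; have mAB := measurableI _ _ mA mB.
rewrite -PE; last exact: measurableU.
rewrite measureUfinr//; last exact: le_lt_trans (probability_le1 mu mB) (ltry _).
rewrite EFinB EFinD -!PE//.
Qed.

Let P_ge0 A : 0 <= P A.
Proof. by rewrite fine_ge0. Qed.

(** Among sufficiently many events of probability a, two have an intersection of
    probability bounded below: otherwise the probability of their union would
    exceed 1.  Both M and delta depend on a alone. *)
Lemma recurrence (a : R) : 0 < a -> exists M : nat, exists2 delta : R, 0 < delta &
  forall A : nat -> set X, (forall j, measurable (A j)) ->
    (forall j, mu (A j) = a%:E) ->
    exists j l, [/\ (j < l)%N, (l < M)%N & (delta%:E <= mu (A j `&` A l))%E].
Proof.
move=> a0; pose M := (Num.truncn (3 / a)).+1.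
(* With M a > 3 and all pairwise intersections below 1 / M ^ 2, the union of M
   events would have probability at least M a - 1 > 2. *)
have Ma : 3 < M%:R * a by rewrite -ltr_pdivrMr// truncnS_gt.
have M0 : 0 < M%:R :> R by rewrite ltr0n.
exists M, (M%:R ^- 2); first by rewrite invr_gt0 exprn_gt0.
move=> A mA Aa; apply: contrapT => H.
have small j l : (j < l)%N -> (l < M)%N -> P (A j `&` A l) <= M%:R ^- 2.
  move=> jl lM; rewrite leNgt; apply/negP => big; apply: H; exists j, l; split=> //.
  by rewrite PE ?lee_fin; [exact: ltW|exact: measurableI].
pose B m := \big[setU/set0]_(j < m) A j.
have mB m : measurable (B m) by exact: bigsetU_measurable.
have BS m : B m.+1 = B m `|` A m by rewrite /B big_ord_recr.
have BA m l : (m <= l)%N -> (l < M)%N -> P (B m `&` A l) <= m%:R * M%:R ^- 2.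
  elim: m => [|m IH] ml lM.
    by rewrite /B big_ord0 set0I /P measure0 mul0r.
  rewrite BS setIUl PU; [|exact: measurableI|exact: measurableI].
  have := IH (ltnW ml) lM; have := small _ _ ml lM.
  have := P_ge0 (B m `&` A l `&` (A m `&` A l)).
  by rewrite -natr1 mulrDl mul1r; lra.
have PB m : (m <= M)%N -> m%:R * a - m%:R * (M%:R * M%:R ^- 2) <= P (B m).
  elim: m => [|m IH] mM; first by rewrite !mul0r subr0.
  rewrite BS PU//.
  have := IH (ltnW mM); have := BA m m (leqnn _) mM.
  have -> : P (A m) = a by rewrite /P Aa.
  have : m%:R * M%:R ^- 2 <= M%:R * M%:R ^- 2 :> R.
    by rewrite ler_wpM2r ?invr_ge0 ?exprn_ge0// ler_nat ltnW.
  by rewrite -natr1 !mulrDl !mul1r; lra.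
have := PB M (leqnn _); have := P_le1 (mB M).
have -> : M%:R * (M%:R * M%:R ^- 2) = 1 :> R by field; rewrite lt0r_neq0.
by lra.
Qed.

End Pigeonhole.

(** * Points fixed up to a germ *)

Section Germs.
Context d (X : measurableType d) (R : realType) (mu : probability X R).
Variables (G : groupType) (act : G -> X -> X).
Hypothesis act_mp : mp_action mu act.
Hypothesis mfix : forall g, measurable (fix_set act g).
Variables (T : Type) (ev : G -> T -> T) (D : set T) (region : set (set T)).
Hypothesis fl : flexible ev D region.
Hypothesis countG : countable [set: G].
Local Open Scope group_scope.

Let actM := actM act_mp.
Let actK := actK act_mp.
Let actVK := actVK act_mp.

(** A weakening of Fix(q): the stabilizer of the point need not contain q, only
    an element that looks like q on U. *)
Definition germ_set (q : G) (U : set T) : set X :=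
  [set x | exists h, (forall y, U y -> ev h y = ev q y) /\ act h x = x].

Lemma measurable_germ_set q U : measurable (germ_set q U).
Proof.
pose F h := if `[< forall y, U y -> ev h y = ev q y >] then fix_set act h else set0.
rewrite (_ : germ_set q U = \bigcup_h F h); last first.
  apply/seteqP; split=> [x [h [hq hx]]|x [h _]].
    by exists h => //; rewrite /F asboolT.
  by rewrite /F; case: asboolP => // hq hx; exists h.
apply: countable_bigcupT_measurable => // h.
by rewrite /F; case: ifP => _; [exact: mfix|exact: measurable0].
Qed.

Section Copies.
Variables (q : G) (U : set T).
Hypotheses (rU : region U) (DU : D `\` U !=set0).
Hypothesis qU : forall x, U x -> U (ev q x).

(** The translate of the germ set by t, that is, the germ set of the conjugate
    of q by t on the image of U under t. *)
Definition copy t : set X := act t^-1 @^-1` germ_set q U.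

Lemma measurable_copy t : measurable (copy t).
Proof. exact/(measurable_act act_mp)/measurable_germ_set. Qed.

Lemma copyM u t : copy (u * t) = act u^-1 @^-1` copy t.
Proof. by apply/seteqP; split=> x; rewrite /copy /= invgM actM. Qed.

(** An element that is the identity on U normalizes the elements that agree with
    q on U, since q maps U into itself. *)
Lemma copy_germ_sub t t' : (forall x, U x -> ev t x = ev t' x) ->
  copy t `<=` copy t'.
Proof.
move=> tt' x [h [hq hx]]; exists (t'^-1 * t * h * t^-1 * t'); split.
  move=> y Uy; rewrite !(flexM fl) -(tt' y)// (evK fl) hq// tt' ?(evK fl)//.
  exact: qU.
by rewrite !actM actVK hx actVK.
Qed.

Lemma copy_germ t t' : (forall x, U x -> ev t x = ev t' x) -> copy t = copy t'.
Proof.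
move=> tt'; apply/seteqP; split; apply: copy_germ_sub => //.
by move=> x /tt'.
Qed.

Definition separated (N : nat) (t : nat -> G) :=
  (forall i j x y, (i < N)%N -> (j < N)%N -> U x -> U y ->
     ev (t i) x = ev (t j) y -> i = j) /\
  exists x, D x /\ forall i, (i < N)%N -> ~ (ev (t i) @` U) x.

(** Gluing yields a single u with t' i = u * t i on U for all i < N, and then u
    carries one intersection to the other. *)
Lemma measure_copies N t t' : separated N t -> separated N t' ->
  mu (\bigcap_(i < N) copy (t i)) = mu (\bigcap_(i < N) copy (t' i)).
Proof.
move=> [tI [x0 [Dx0 tx0]]] [t'I [y0 [Dy0 ty0]]].
have [||||||u [_ uP]] := glue_family fl (N := N) (P0 := set0) (P := fun i => ev (t i) @` U)
  (f := fun i => t' i * (t i)^-1) (region0 fl).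
- by move=> i iN; exact: (flex_image fl).
- by move=> i x _ _; split.
- by move=> i j _ iN jN [x Ux <-] [y Uy] /esym; apply: tI.
- move=> i j _ _ iN jN [x Ux <-] [y Uy <-]; rewrite !(flexM fl) !(evK fl).
  exact: t'I.
- by exists x0; split.
- exists y0; split=> // i iN [_ [x Ux <-]]; rewrite (flexM fl) (evK fl) => xy.
  by apply: (ty0 i iN); exists x.
have E i : (i < N)%N -> copy (t' i) = act u^-1 @^-1` copy (t i).
  move=> iN; rewrite -copyM; apply: copy_germ => x Ux.
  by rewrite (flexM fl) (uP i)// (flexM fl) (evK fl).
have -> : \bigcap_(i < N) copy (t' i) = act u^-1 @^-1` (\bigcap_(i < N) copy (t i)).
  apply/seteqP; split=> x /= H i iN; first by have := H i iN; rewrite E.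
  by rewrite E//; exact: H.
case: act_mp => _ _ _ ->//.
by apply: bigcap_measurableType => i _; exact: measurable_copy.
Qed.

Definition separated_seq (t : nat -> G) :=
  (forall i j x y, U x -> U y -> ev (t i) x = ev (t j) y -> i = j) /\
  exists x, D x /\ forall i, ~ (ev (t i) @` U) x.

Lemma separated_seqW N t : separated_seq t -> separated N t.
Proof.
move=> [tI [x [Dx tx]]]; split; first by move=> i j y z _ _; exact: tI.
by exists x; split=> // i _.
Qed.

Lemma cvg_copies t :
  mu (\bigcap_(i < N) copy (t i)) @[N --> \oo] --> mu (\bigcap_i copy (t i)).
Proof.
have -> : \bigcap_i copy (t i) = \bigcap_N \bigcap_(i < N) copy (t i).
  apply/seteqP; split=> [x H N _ i _|x H i _]; first exact: H.
  by apply: (H i.+1) => //=.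
apply: (@nonincreasing_cvg_mu _ _ _ mu (fun N => \bigcap_(i < N) copy (t i))).
- apply: le_lt_trans (probability_le1 mu _) (ltry _).
  by apply: bigcap_measurableType => i _; exact: measurable_copy.
- by move=> N; apply: bigcap_measurableType => i _; exact: measurable_copy.
- apply: bigcap_measurableType => N _.
  by apply: bigcap_measurableType => i _; exact: measurable_copy.
- move=> N M NM; apply/subsetPset => x H i /= iN; apply: H => /=.
  exact: leq_trans NM.
Qed.

Lemma measure_copies_seq t t' : separated_seq t -> separated_seq t' ->
  mu (\bigcap_i copy (t i)) = mu (\bigcap_i copy (t' i)).
Proof.
move=> st st'; have E : (fun N => mu (\bigcap_(i < N) copy (t i))) =
    (fun N => mu (\bigcap_(i < N) copy (t' i))).
  by apply/funext => N; apply: measure_copies; exact: separated_seqW.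
have ct := @cvg_copies t; rewrite E in ct.
exact: (cvg_unique (@ereal_hausdorff R) ct (@cvg_copies t')).
Qed.

(** Adding u in front of the sequence t gives another sequence of disjoint
    copies, so the intersection keeps its measure although it is now contained
    in the copy at u. *)
Lemma copies_absorb (t : nat -> G) (e : set T) (u : G) : (forall i x, U x -> e (ev (t i) x)) ->
  (forall i j x y, U x -> U y -> ev (t i) x = ev (t j) y -> i = j) ->
  (forall x, U x -> ~ e (ev u x)) ->
  (exists x, [/\ D x, ~ e x & ~ (ev u @` U) x]) ->
  mu.-negligible (\bigcap_i copy (t i) `\` copy u).
Proof.
move=> te tI ue [x0 [Dx0 ex0 ux0]].
pose t' i := if i is i'.+1 then t i' else u.
have st : separated_seq t.
  by split=> //; exists x0; split=> // i [y /(te i) ey yx]; apply: ex0; rewrite -yx.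
have st' : separated_seq t'.
  split; last first.
    by exists x0; split=> // -[//|i] [y /(te i) ey yx]; apply: ex0; rewrite -yx.
  move=> [|i] [|j] x y Ux Uy //= E.
  - by case: (ue x Ux); rewrite E; exact: te.
  - by case: (ue y Uy); rewrite -E; exact: te.
  - by congr S; exact: tI Ux Uy E.
have mT : measurable (\bigcap_i copy (t i)).
  by apply: bigcap_measurableType => i _; exact: measurable_copy.
suff E : mu (\bigcap_i copy (t i) `\` copy u) = 0%E.
  by apply/negligibleP => //; apply: measurableD => //; exact: measurable_copy.
have -> : \bigcap_i copy (t i) `\` copy u =
    \bigcap_i copy (t i) `\` \bigcap_i copy (t' i).
  apply/seteqP; split=> x [H nu]; split=> //.
    by move=> H'; apply: nu; exact: (H' 0%N).
  by move=> ux; apply: nu => -[|i] _ //; exact: H.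
have mT' : measurable (\bigcap_i copy (t' i)).
  by apply: bigcap_measurableType => i _; exact: measurable_copy.
have TT' : \bigcap_i copy (t' i) `<=` \bigcap_i copy (t i).
  by move=> x H i _; exact: (H i.+1).
have fT : mu (\bigcap_i copy (t i)) \is a fin_num by exact: fin_num_measure.
have -> : mu (\bigcap_i copy (t i) `\` \bigcap_i copy (t' i)) =
    (mu (\bigcap_i copy (t i)) - mu (\bigcap_i copy (t' i)))%E.
  rewrite -[in X in (_ - X)%E](setIidr TT'); apply: measureD => //.
  exact: le_lt_trans (probability_le1 mu mT) (ltry _).
by rewrite (measure_copies_seq st' st) subee.
Qed.

Lemma copies_absorb_seq (t : nat -> G) (e : set T) (t' : nat -> G) (e' : set T) :
  (forall i x, U x -> e (ev (t i) x)) ->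
  (forall i j x y, U x -> U y -> ev (t i) x = ev (t j) y -> i = j) ->
  (forall i x, U x -> e' (ev (t' i) x)) ->
  (forall x, e x -> ~ e' x) ->
  (exists x, [/\ D x, ~ e x & ~ e' x]) ->
  mu.-negligible (\bigcap_i copy (t i) `\` \bigcap_i copy (t' i)).
Proof.
move=> te tI te' ee' [x0 [Dx0 ex0 ex0']].
apply: (@negligibleS _ _ _ _ (\bigcup_k (\bigcap_i copy (t i) `\` copy (t' k)))).
  move=> x [H /existsNP[k /not_implyP[_ nk]]]; by exists k.
apply: negligible_bigcup => k; apply: (@copies_absorb t e) => //.
  by move=> x Ux ex; apply: (ee' _ ex); exact: te'.
by exists x0; split=> // -[y /(te' k) ey yx]; apply: ex0'; rewrite -yx.
Qed.

Lemma negligibleB_trans (A B C : set X) : mu.-negligible (A `\` B) ->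
  mu.-negligible (B `\` C) -> mu.-negligible (A `\` C).
Proof.
move=> AB BC; apply: negligibleS (negligibleU AB BC) => x [Ax Cx].
by have [Bx|nBx] := pselect (B x); [right|left].
Qed.

(** For one fixed sequence t1 of disjoint copies, the intersection of the copies
    is almost contained in every copy, even in a copy at u that overlaps the
    region e1 where t1 lives.  To see this, pass to a sequence inside a small
    region e' that avoids the copy at u.  As e' may be taken disjoint from e1 or
    from a second region e2, the comparison goes through t1 or through a
    sequence t2 living in e2. *)
Lemma germ_set_full (delta : R) : (0 < delta)%R ->
  (forall N, exists2 t, separated N t &
     (delta%:E <= mu (\bigcap_(i < N) copy (t i)))%E) ->
  ergodic_action mu act -> mu (germ_set q U) = 1%E.
Proof.
move=> delta0 lower erg.
have D0 : D !=set0 by have [x []] := DU; exists x.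
have [e1 [re1 _ e10 De1]] := flex_split fl (flex_full fl) D0.
have rD1 : region (D `\` e1) by apply: (flexB fl) => //; exact: flex_full fl.
have [e2 [re2 e2D e20 De2]] := flex_split fl rD1 De1.
have e12 x : e1 x -> ~ e2 x by move=> e1x /e2D[].
have [x0 [[Dx0 nx1] nx2]] := De2.
have [t1 [te1 tI1]] := disjoint_copies fl rU DU re1 e10.
have [t2 [te2 tI2]] := disjoint_copies fl rU DU re2 e20.
have T12 : mu.-negligible (\bigcap_i copy (t1 i) `\` \bigcap_i copy (t2 i)).
  by apply: (@copies_absorb_seq _ e1 _ e2) => //; exists x0.
have T1u u : mu.-negligible (\bigcap_i copy (t1 i) `\` copy u).
  have ruU := flex_image fl u rU.
  have [ea [ta [rea tea tIa Ta [e0 [re0 e00 e0a e0u]]]]] :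
      exists (ea : set T) (ta : nat -> G),
      [/\ region ea, forall i x, U x -> ea (ev (ta i) x),
        forall i j x y, U x -> U y -> ev (ta i) x = ev (ta j) y -> i = j,
        mu.-negligible (\bigcap_i copy (t1 i) `\` \bigcap_i copy (ta i)) &
        exists e0 : set T, [/\ region e0, e0 !=set0, forall x, e0 x -> ~ ea x &
          forall x, e0 x -> ~ (ev u @` U) x]].
    have rC : region (D `\` ev u @` U).
      by apply: (flexB fl) => //; exact: flex_full fl.
    have [C1|C1] := pselect ((D `\` ev u @` U) `\` e1 !=set0).
      exists e1, t1; split=> //.
        by rewrite setDv; exact: negligible_set0.
      by exists ((D `\` ev u @` U) `\` e1); split=> [|//|x []//|x [[]]//]; exact: (flexB fl).
    exists e2, t2; split=> //; exists (D `\` ev u @` U); split=> //.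
    - have [x [Dx nUx]] := DU; exists (ev u x); split; first exact: (flexD fl).
      by move=> [y Uy /(ev_inj fl) yx]; apply: nUx; rewrite -yx.
    - move=> x Cx e2x; apply: C1; exists x; split=> // e1x; exact: e12 e2x.
    - by move=> x [].
  have [e' [re' e'0 e'n [y0 [y0e ny0]]]] := flex_split fl re0 e00.
  have [t' [te' tI']] := disjoint_copies fl rU DU re' e'n.
  have Dy0 : D y0 by exact: (flex_sub fl re0).
  apply: negligibleB_trans Ta _.
  apply: (@negligibleB_trans _ (\bigcap_i copy (t' i))).
    apply: (@copies_absorb_seq _ ea _ e') => //; last by exists y0; split=> //; exact: e0a.
    by move=> x eax /e'0 /e0a.
  apply: (@copies_absorb _ e') => //; last by exists y0; split=> //; exact: e0u.
  by move=> x Ux /e'0 /e0u; apply; exists x.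
pose I := \bigcap_u copy u.
have IE : I = ~` \bigcup_u ~` copy u.
  by rewrite setC_bigcup; apply: eq_bigcapr => u _; rewrite setCK.
have mI : measurable I.
  rewrite IE; apply: measurableC; apply: countable_bigcupT_measurable => // u.
  exact/measurableC/measurable_copy.
have T1I : mu.-negligible (\bigcap_i copy (t1 i) `\` I).
  have /countable_injP[f fI] := countG.
  have /choice[e eP] : forall k, exists g, forall h, f h = k -> h = g.
    move=> k; have [[g gk]|ng] := pselect (exists g, f g = k).
      by exists g => h hk; apply: fI; rewrite ?in_setT// hk.
    by exists 1 => h hk; case: ng; exists h.
  apply: (negligibleS _ (negligible_bigcup (fun k => T1u (e k)))).
  move=> x [Hx /existsNP[u /not_implyP[_ nu]]]; exists (f u) => //; split=> //.
  by rewrite -(eP (f u) u).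
have mT1 : measurable (\bigcap_i copy (t1 i)).
  by apply: bigcap_measurableType => i _; exact: measurable_copy.
have T1pos : (delta%:E <= mu (\bigcap_i copy (t1 i)))%E.
  apply: cvge_ge (@cvg_copies t1); near=> N.
  have [t sept] := lower N; move/le_trans; apply; rewrite (measure_copies sept (t' := t1))//.
  apply: separated_seqW; split=> //; exists x0; split=> // i [y /(te1 i) ey yx].
  by apply: nx1; rewrite -yx.
have Ipos : mu I <> 0%E.
  move=> I0; have : mu.-negligible (\bigcap_i copy (t1 i)).
    apply: negligibleS (negligibleU T1I (_ : mu.-negligible I)).
      by move=> x Tx; have [Ix|nIx] := pselect (I x); [right|left].
    exact/negligibleP.
  move=> /negligibleP -/(_ mT1) T0; move: T1pos; rewrite T0 lee_fin.
  by rewrite leNgt delta0.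
have [g|//|I1] := erg _ mI.
  apply/seteqP; split=> x /= H u _.
    by have := H (g * u) Logic.I; rewrite copyM /= actK.
  have := H (g^-1 * u) Logic.I; rewrite copyM /= invgK.
  by [].
apply: (@le_anti _ _ _ _ _); apply/andP; split.
  exact/probability_le1/measurable_germ_set.
rewrite -I1; apply: le_measure; rewrite ?inE//; first exact: measurable_germ_set.
move=> x /(_ 1 Logic.I); rewrite /copy /=.
by rewrite invg1; case: act_mp => ->.
Unshelve. all: by end_near. Qed.

End Copies.
End Germs.

(** * Essential freeness for flexible actions *)

Section EssentiallyFree.
Context d (X : measurableType d) (R : realType) (mu : probability X R).
Variables (G : groupType) (act : G -> X -> X).
Hypothesis act_mp : mp_action mu act.
Hypothesis mfix : forall g, measurable (fix_set act g).
Variables (T : Type) (ev : G -> T -> T) (D : set T) (region : set (set T)).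
Hypothesis fl : flexible ev D region.
Hypothesis countG : countable [set: G].
Local Open Scope group_scope.

Let actM := actM act_mp.
Let actK := actK act_mp.
Let actVK := actVK act_mp.

(** The bound is the recurrence constant of the conjugates of Fix(g) and does not
    depend on N. *)
Lemma copies_lower_bound (g q : G) (U : set T) :
  g <> 1 -> mu (fix_set act g) <> 0%E ->
  region U -> D `\` U !=set0 -> (forall x, U x -> U (ev q x)) ->
  exists2 delta : R, (0 < delta)%R & forall N,
    exists2 t, separated ev D U N t &
      (delta%:E <= mu (\bigcap_(i < N) copy act ev q U (t i)))%E.
Proof.
move=> g1 fg0 rU DU qU.
have [V [rV V0 gV]] := flex_displace fl g1.
have [e [re eV e0 [x0 [Vx0 ex0]]]] := flex_split fl rV V0.
have [t [te tI]] := disjoint_copies fl rU DU re e0.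
have VD := flex_sub fl rV.
pose a := fine (mu (fix_set act g)).
have aE : mu (fix_set act g) = a%:E by rewrite fineK// fin_num_measure.
have a0 : (0 < a)%R.
  rewrite lt0r fine_ge0// andbT; apply/eqP => a0.
  by apply: fg0; rewrite aE a0.
have [M [delta delta0 rec]] := recurrence mu a0.
exists delta => // -[|N].
  exists t; first by split=> //; have [x [Dx _]] := DU; exists x.
  have [j [l [_ _ /le_trans]]] := rec (fun=> fix_set act g) (fun=> mfix g) (fun=> aE).
  apply; rewrite [X in (_ <= mu X)%E](_ : _ = setT).
    by rewrite probability_setT; apply: probability_le1; exact: measurableI.
  by apply/seteqP; split=> // x _ i.
pose b i := t i * q * (t i)^-1.
have bE i x : ev (b i) (ev (t i) x) = ev (t i) (ev q x).
  by rewrite !(flexM fl) (evK fl).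
(* The disjoint copies of U are grouped into blocks of N.+1, and h j acts as q
   on the copies of the j-th block and trivially elsewhere. *)
pose f j i := if (i %/ N.+1 == j)%N then b i else 1.
have fU i j x : U x -> (ev (t i) @` U) (ev (f j i) (ev (t i) x)).
  move=> Ux; rewrite /f; case: ifP => _; first by rewrite bE; exists (ev q x) => //; exact: qU.
  by rewrite (flex1 fl); exists x.
have /choice[h hP] : forall j, exists u, (forall x, (D `\` V) x -> ev u x = x) /\
    forall i x, (i < M * N.+1)%N -> (ev (t i) @` U) x -> ev u x = ev (f j i) x.
  move=> j; apply: (glue_family fl).
  - by apply: (flexB fl) => //; exact: flex_full fl.
  - by move=> i _; exact: (flex_image fl).
  - move=> i _ _ [x Ux <-]; split; first by move=> [_]; apply; apply/eV/te.
    by have [y Uy <-] := fU i j x Ux; move=> [_]; apply; apply/eV/te.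
  - by move=> i k _ _ _ [x Ux <-] [y Uy] /esym; exact: tI.
  - move=> i k _ _ _ _ [x Ux <-] [y Uy <-].
    have [x' Ux' <-] := fU i j x Ux; have [y' Uy' <-] := fU k j y Uy.
    exact: tI.
  - exists x0; split; [exact: VD|by case|].
    by move=> i _ [x /(te i) ex xx]; apply: ex0; rewrite -xx.
  - exists x0; split; [exact: VD|by case|].
    move=> i _ [_ [x Ux <-]]; have [y /(te i) ey <-] := fU i j x Ux.
    by move=> yx; apply: ex0; rewrite -yx.
have [|j|j [l [jl lM big]]] := rec (fun j => act (h j)^-1 @^-1` fix_set act g).
- by move=> j; apply: (measurable_act act_mp).
- by case: act_mp => _ _ _ ->.
pose t' i := t (j * N.+1 + i)%N.
exists t'.
  split; last first.
    exists x0; split=> [|i _ [x /(te (j * N.+1 + i)%N) ex xx]]; first exact: VD.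
    by apply: ex0; rewrite -xx.
  by move=> i k x y _ _ Ux Uy /(tI _ _ _ _ Ux Uy) /addnI.
have mC : measurable (\bigcap_(i < N.+1) copy act ev q U (t' i)).
  by apply: bigcap_measurableType => i _; exact: (measurable_copy act_mp mfix).
apply: le_trans big _.
have <- : mu (act (h j)^-1 @^-1` \bigcap_(i < N.+1) copy act ev q U (t' i)) =
    mu (\bigcap_(i < N.+1) copy act ev q U (t' i)) by case: act_mp => _ _ _ ->.
apply: le_measure; rewrite ?inE.
- by apply: measurableI; apply: (measurable_act act_mp).
- exact: (measurable_act act_mp).
move=> x [/= gj gl] i /= iN; rewrite /fix_set /= in gj gl.
set y := act (h j)^-1 x in gj *.
set k := (j * N.+1 + i)%N.
(* Both g and its conjugate by w fix y, so that g^-1 * (w * g * w^-1) does.  On V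
   this element is w^-1 = (h l)^-1 * h j, because g maps V off V and w is the
   identity off V; and w^-1 agrees with h j on the copies of the j-th block. *)
pose w := (h j)^-1 * h l.
have wy : act (w * g * w^-1) y = y.
  by rewrite /w /y invgM invgK !actM !actVK gl actVK.
have gwy : act (g^-1 * (w * g * w^-1)) y = y.
  by rewrite actM wy (act_fixV act_mp).
have kM : (k < M * N.+1)%N.
  by rewrite /k; have : (j.+1 * N.+1 <= M * N.+1)%N; [rewrite leq_mul2r; lia|lia].
have kj : (k %/ N.+1)%N = j by rewrite /k divnMDl// divn_small ?addn0.
have hjk z : U z -> ev (h j) (ev (t k) z) = ev (t k) (ev q z).
  by move=> Uz; have [_ /(_ k) ->//] := hP j; rewrite /f kj eqxx bE.
have hlk z : U z -> ev (h l)^-1 (ev (t k) z) = ev (t k) z.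
  move=> Uz; rewrite -[X in ev _ X](_ : ev (h l) (ev (t k) z) = ev (t k) z) ?(evK fl)//.
  have [_ /(_ k) ->//] := hP l.
  by rewrite /f kj ltn_eqF ?(flex1 fl).
have hV m z : (D `\` V) z -> ev (h m) z = z.
  by have [+ _] := hP m; apply.
have hVV m z : (D `\` V) z -> ev (h m)^-1 z = z.
  by move=> Vz; rewrite -{1}(hV m z Vz) (evK fl).
exists ((t k)^-1 * (g^-1 * (w * g * w^-1)) * t k); split; last first.
  by rewrite actM actVK actM gwy.
move=> z Uz; rewrite /w invgM invgK !(flexM fl) hjk// (hlk _ (qU _ Uz)).
have Vz : V (ev (t k) (ev q z)) by apply/eV/te/qU.
have DVg : (D `\` V) (ev g (ev (t k) (ev q z))).
  by split; [apply: (flexD fl); exact: VD|exact: gV].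
by rewrite (hV l _ DVg) (hVV j _ DVg) !(evK fl).
Qed.

Theorem flexible_essentially_free : simple_group G -> ergodic_action mu act ->
  ~ trivial_action mu act -> essentially_free_action mu act.
Proof.
move=> simp erg ntriv g g1; apply: contrapT => fg0.
have full q U : region U -> D `\` U !=set0 -> (forall x, U x -> U (ev q x)) ->
    mu (germ_set act ev q U) = 1%E.
  move=> rU DU qU; have [delta delta0 low] := copies_lower_bound g1 fg0 rU DU qU.
  exact: (germ_set_full act_mp mfix fl countG rU DU qU delta0 low).
apply: ntriv.
have D0 : D !=set0.
  have [V [rV [x Vx] _]] := flex_displace fl g1.
  by exists x; exact: (flex_sub fl rV).
have rD := flex_full fl.
have split2 P : region P -> P !=set0 -> exists A B, [/\ region A, region B,
    A !=set0, B !=set0 & (A `<=` P) /\ (B `<=` P) /\ (forall x, A x -> ~ B x) /\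
    (forall x, P x -> A x \/ B x)].
  move=> rP P0; have [Q [rQ QP Q0 PQ]] := flex_split fl rP P0.
  exists Q, (P `\` Q); split=> //; first exact: (flexB fl).
  split=> //; split; first by move=> x [].
  split; first by move=> x Qx [].
  by move=> x Px; have [?|?] := pselect (Q x); [left|right].
have [U [Z [rU rZ U0 Z0 [_ [_ [UZ DUZ]]]]]] := split2 D rD D0.
have [Z1 [Z2 [rZ1 rZ2 Z10 Z20 [Z1Z [Z2Z [Z12 ZZ]]]]]] := split2 Z rZ Z0.
have [A [B [rA rB A0 B0 [AU [BU [AB UAB]]]]]] := split2 U rU U0.
(* The element q sends P0 into P1, while k fixes P0 and sends P1 into P2; the
   point x0 of A' and the region P1 in B leave the room that gluing needs. *)
have [P0 [A' [rP0 rA' P00 A'0 [P0A [A'A [P0A' _]]]]]] := split2 A rA A0.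
have [P1 [P2 [rP1 rP2 P10 P20 [P1B [P2B [P12 _]]]]]] := split2 B rB B0.
have [x0 A'x0] := A'0.
have rDU : region (D `\` U) by exact: (flexB fl).
have PD P : P `<=` U -> D `\` P !=set0.
  move=> PU; have [z Zz] := Z0; exists z; split; first exact: (flex_sub fl rZ).
  by move=> /PU /UZ.
have [s sP] := flex_compress fl rP1 rP0 P10 (PD _ (subset_trans P0A AU)).
have [s' s'P] := flex_compress fl rP2 rP1 P20 (PD _ (subset_trans P1B BU)).
have sP1 x : P0 x -> P1 (ev s x) by move=> Px; apply: sP; exists x.
have s'P2 x : P1 x -> P2 (ev s' x) by move=> Px; apply: s'P; exists x.
have Dx0 : D x0 by apply: (flex_sub fl rA').
have Ux0 : U x0 by apply/AU/A'A.
have [q [qD qP]] : exists u, (forall x, (D `\` U) x -> ev u x = x) /\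
    (forall x, P0 x -> ev u x = ev s x).
  apply: (glue2 fl) => //.
  - by move=> x [_ nU] /P0A/AU.
  - by move=> x /sP1/P1B/BU Ux [_].
  - by exists x0; split=> // -[[]//|/P0A']; exact.
  - exists x0; split=> // -[[]//|[y /sP1/P1B By yx]].
    by apply: (AB x0); [exact: A'A|rewrite -yx].
have [k [kD kP]] : exists u, (forall x, ((D `\` U) `|` P0) x -> ev u x = x) /\
    (forall x, P1 x -> ev u x = ev s' x).
  apply: (glue2 fl) => //; first exact: (flexU fl).
  - by move=> x [[_ nU] /P1B/BU//|/P0A Ax /P1B]; exact: AB.
  - by move=> x /s'P2/P2B Bx [[_]|/P0A/AB]; [apply; exact: BU|exact].
  - exists x0; split=> // -[[[]//|/P0A']|/P1B]; first exact.
    by apply: AB; exact: A'A.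
  - exists x0; split=> // -[[[]//|/P0A']|[y /s'P2/P2B By yx]]; first exact.
    by apply: (AB x0); [exact: A'A|rewrite -yx].
have stab v x : (forall x, (D `\` U) x -> ev v x = x) -> U x -> U (ev v x).
  move=> vD Ux; apply: contrapT => nU.
  have Dx : D x by exact: (flex_sub fl rU).
  have /(ev_inj fl) vx : ev v (ev v x) = ev v x by apply: vD; split=> //; exact: (flexD fl).
  by apply: nU; rewrite vx.
have kD' x : (D `\` U) x -> ev k x = x by move=> ?; apply: kD; left.
have ZD : Z `<=` D `\` U.
  by move=> x Zx; split; [exact: (flex_sub fl rZ)|move=> /UZ].
have fullq : mu (germ_set act ev q (U `|` Z2)) = 1%E.
  apply: full; first exact: (flexU fl).
    have [z Z1z] := Z10; exists z; split; first by apply: (flex_sub fl rZ1).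
    by move=> [/UZ|/(Z12 _ Z1z)//]; apply; exact: Z1Z.
  move=> x [/(stab q _ qD)|Z2x]; [by left|right].
  by rewrite qD//; apply/ZD/Z2Z.
have fullk : mu (germ_set act ev k (U `|` Z1)) = 1%E.
  apply: full; first exact: (flexU fl).
    have [z Z2z] := Z20; exists z; split; first by apply: (flex_sub fl rZ2).
    by move=> [/UZ|/Z12]; apply => //; exact: Z2Z.
  move=> x [/(stab k _ kD')|Z1x]; [by left|right].
  by rewrite kD'//; apply/ZD/Z1Z.
have c1 : (k * q)^-1 * (q * k) <> 1.
  move=> /(congr1 (fun c => (k * q) * c)); rewrite mulgA mulgV mul1g mulg1 => qk.
  have [x Px] := P00.
  have : ev (q * k) x = ev (k * q) x by rewrite qk.
  rewrite !(flexM fl) kD; last by right.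
  rewrite qP// kP; last exact: sP1.
  by move=> E; apply: (P12 (ev s x)); [exact: sP1|rewrite E; apply/s'P2/sP1].
apply: (simple_trivial_action act_mp simp c1).
have mg q' U' : measurable (germ_set act ev q' U') by exact: (measurable_germ_set mfix).
apply: filterS2 (full_ae (mg _ _) fullq) (full_ae (mg _ _) fullk) => x.
move=> [h [hq hx]] [l [lk lx]].
have hU y : U y -> ev h y = ev q y by move=> Uy; apply: hq; left.
have lU y : U y -> ev l y = ev k y by move=> Uy; apply: lk; left.
have h2 y : Z2 y -> ev h y = y.
  by move=> Zy; rewrite hq; [apply/qD/ZD/Z2Z|right].
have l1 y : Z1 y -> ev l y = y.
  by move=> Zy; rewrite lk; [apply/kD'/ZD/Z1Z|right].
have surjU v y : (forall x, (D `\` U) x -> ev v x = x) -> U y ->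
    exists2 z, U z & ev v z = y.
  move=> vD Uy; exists (ev v^-1 y); last by rewrite (evVK fl).
  apply: stab => // z Dz; have vz := vD z Dz.
  by rewrite -{1}vz (evK fl).
have h1 y : Z1 y -> Z1 (ev h y).
  move=> Zy; have Dhy : D (ev h y) by apply/(flexD fl)/(flex_sub fl rZ1).
  have [Uhy|/ZZ[//|Z2hy]] := DUZ _ Dhy.
    have [z Uz zE] := surjU q _ qD Uhy; exfalso.
    rewrite -hU// in zE; have yz := ev_inj fl zE.
    by apply: (UZ z) => //; rewrite yz; exact: Z1Z.
  have /(ev_inj fl) yE := h2 _ Z2hy; exfalso.
  by apply: (Z12 y) => //; rewrite -yE.
have l2 y : Z2 y -> Z2 (ev l y).
  move=> Zy; have Dly : D (ev l y) by apply/(flexD fl)/(flex_sub fl rZ2).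
  have [Uly|/ZZ[Z1ly|//]] := DUZ _ Dly.
    have [z Uz zE] := surjU k _ kD' Uly; exfalso.
    rewrite -lU// in zE; have yz := ev_inj fl zE.
    by apply: (UZ z) => //; rewrite yz; exact: Z2Z.
  have /(ev_inj fl) yE := l1 _ Z1ly; exfalso.
  by apply: (Z12 y) => //; rewrite -yE.
have inv v y z : ev v y = z -> ev v^-1 z = y by move=> <-; rewrite (evK fl).
(* On U, h and l agree with q and k; on Z1 and Z2 one of h and l is the
   identity and the other one preserves the region. *)
have -> : (k * q)^-1 * (q * k) = (l * h)^-1 * (h * l).
  apply: (ev_ext fl) => y Dy; rewrite !(flexM fl _ _ y).
  have fixZ z : Z z -> ev (k * q)^-1 (ev q (ev k z)) = z.
    by move=> /ZD Dz; rewrite kD'// qD//; apply: inv; rewrite (flexM fl) qD// kD'.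
  have [Uy|/ZZ[Zy|Zy]] := DUZ y Dy.
  - rewrite (lU _ Uy) hU; last exact: stab.
    have [z Uz zE] := surjU _ _ kD' (stab q _ qD (stab k _ kD' Uy)).
    have [z' Uz' z'E] := surjU _ _ qD Uz.
    have E : ev (k * q) z' = ev q (ev k y) by rewrite (flexM fl) z'E.
    have E' : ev (l * h) z' = ev q (ev k y) by rewrite (flexM fl) hU// z'E lU.
    by rewrite (inv _ _ _ E) (inv _ _ _ E').
  - by rewrite fixZ; [rewrite l1// (inv _ y)// (flexM fl) l1//; exact: h1|exact: Z1Z].
  - rewrite fixZ; last exact: Z2Z.
    by rewrite (h2 _ (l2 _ Zy)) (inv _ y)// (flexM fl) h2.
have lhx : act (l * h) x = x by rewrite actM hx.
by rewrite actM (actM h) lx hx (act_fixV act_mp).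
Qed.

End EssentiallyFree.

(** * Elements of the Higman-Thompson groups *)

Section PiecewiseAffine.
Variables (R : realType) (n r : nat).
Hypothesis n_gt0 : (0 < n)%N.
Implicit Types (h g : R -> R) (x y a b : R).

Lemma raff_eq h g x d : 0 < d -> (forall y, x <= y < x + d -> h y = g y) ->
  raff n g x -> raff n h x.
Proof.
move=> d0 hg [k [e e0 ge]]; exists k, (Num.min d e); first by rewrite lt_min d0.
move=> y /andP[xy]; rewrite -ltrBlDl lt_min !ltrBlDl => /andP[yd ye].
by rewrite !hg ?xy ?lexx ?ltrDl// ge ?xy.
Qed.

Lemma reg_eq h g x d : 0 < d -> (forall y, `|y - x| < d -> h y = g y) ->
  reg n g x -> reg n h x.
Proof.
move=> d0 hg [k [e e0 ge]]; exists k, (Num.min d e); first by rewrite lt_min d0.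
move=> y; rewrite lt_min => /andP[yd ye].
by rewrite !hg ?subrr ?normr0// ge.
Qed.

Lemma raff_affine (k : int) a x : raff n (fun y => n%:R ^ k * y + a) x.
Proof. by exists k, 1 => // y _; ring. Qed.

Lemma reg_affine (k : int) a x : reg n (fun y => n%:R ^ k * y + a) x.
Proof. by exists k, 1 => // y _; ring. Qed.

Lemma raff_if b h g x : raff n h x -> raff n g x ->
  raff n (fun y => if y < b then h y else g y) x.
Proof.
move=> rh rg; have [xb|bx] := ltP x b.
  apply: (@raff_eq _ h _ (b - x)) => //; first by rewrite subr_gt0.
  by move=> y; rewrite addrC subrK => /andP[_ ->].
apply: (@raff_eq _ g _ 1) => // y /andP[xy _].
by rewrite ltNge (le_trans bx xy).
Qed.

Lemma reg_if b h g x : x != b -> reg n h x -> reg n g x ->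
  reg n (fun y => if y < b then h y else g y) x.
Proof.
move=> xb rh rg; case: (ltgtP x b) xb => // xb _.
  apply: (@reg_eq _ h _ (b - x)) => //; first by rewrite subr_gt0.
  move=> y; rewrite ltr_norml => /andP[_]; rewrite ltrD2r.
  by move=> ->.
apply: (@reg_eq _ g _ (x - b)) => //; first by rewrite subr_gt0.
move=> y; rewrite ltr_norml opprB => /andP[+ _]; rewrite ltrD2r => yb.
by rewrite ltNge (ltW yb).
Qed.

Lemma G_intro h g (S : set R) : cancel h g -> cancel g h ->
  (forall x, 0 <= x < r%:R -> 0 <= h x < r%:R) ->
  (forall x, 0 <= x < r%:R -> 0 <= g x < r%:R) ->
  (forall x, ~~ (0 <= x < r%:R) -> h x = x) ->
  (forall x, 0 <= x < r%:R -> raff n h x) ->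
  finite_set S -> S `<=` nadic n ->
  (forall x, 0 < x < r%:R -> ~ S x -> reg n h x) ->
  (forall x, 0 <= x < r%:R -> nadic n x -> nadic n (h x)) ->
  (forall x, 0 <= x < r%:R -> nadic n x -> nadic n (g x)) ->
  G_set n r h.
Proof.
move=> hK gK hD gD hid hr fS SZ Sr hZ gZ; split.
- split=> [x|x y _ _ /(can_inj hK)//|y].
    by rewrite /= !in_itv/=; exact: hD.
  by rewrite /= in_itv/= => /gD gy; exists (g y) => //; rewrite /= in_itv.
- by move=> x; rewrite /= in_itv/= => /hr; exact: raff_cvg.
- by apply: (nadic_PL_intro fS) => // x _; exact: SZ.
- apply/seteqP; split=> [z [x [xZ]]|y [yZ]]; rewrite /= in_itv/= => xr.
    by move=> <-; split; [exact: hZ|rewrite /= in_itv/=; exact: hD].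
  exists (g y) => //; split; first exact: gZ.
  by rewrite /= in_itv/=; exact: gD.
- by move=> x; rewrite in_itv/=; exact: hid.
Qed.

Lemma nadic_nat (p : nat) : nadic n (p%:R : R).
Proof. by exists p, 0%N; rewrite expr0 divr1. Qed.

Lemma nadic_frac (p k : nat) : nadic n (p%:R / n%:R ^+ k : R).
Proof. by exists p, k. Qed.

Lemma nadicMn (k : nat) x : nadic n x -> nadic n (n%:R ^+ k * x).
Proof. by move=> /(nadicM n_gt0 (Posz k)). Qed.

Lemma nadicVn (k : nat) x : nadic n x -> nadic n (x / n%:R ^+ k).
Proof. by move=> /(nadicM n_gt0 (- Posz k)); rewrite -invr_expz mulrC. Qed.

Definition rotation a x :=
  if x < 0 then x else if x < r%:R then
    (if x < r%:R - a then x + a else x + (a - r%:R)) else x.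

Lemma rotation_in a x : 0 <= a <= r%:R -> 0 <= x < r%:R ->
  0 <= rotation a x < r%:R.
Proof.
move=> a01 /andP[x0 xr]; rewrite /rotation ltNge x0 /= xr.
by case: ifP => xa; lra.
Qed.

Lemma rotationK a : 0 <= a <= r%:R ->
  cancel (rotation a) (rotation (r%:R - a)).
Proof.
move=> a01 x; rewrite /rotation.
do !case: ifP; lra.
Qed.

Lemma rotation_G a : 0 <= a <= r%:R -> nadic n a -> G_set n r (rotation a).
Proof.
move=> a01 aZ; have a01' : 0 <= r%:R - a <= r%:R by lra.
have raZ : nadic n (r%:R - a).
  by apply: nadicB => //; [lra|exact: nadic_nat].
have nd b x : 0 <= b <= r%:R -> nadic n b -> 0 <= x < r%:R -> nadic n x ->
    nadic n (rotation b x).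
  move=> b01 bZ /andP[x0 xr] xZ; rewrite /rotation ltNge x0 /= xr.
  have := nadicD n_gt0 xZ bZ; case: ifP => xb xbZ //.
  rewrite addrA; apply: nadicB => //; last exact: nadic_nat.
  by move: xb; rewrite ltNge => /negbFE; lra.
have id_raff x : raff n (fun y : R => y) x.
  apply: (@raff_eq _ (fun y => n%:R ^ 0 * y + 0) _ 1) => //; last exact: raff_affine.
  by move=> y _; rewrite expr0z mul1r addr0.
have sh_raff b x : raff n (fun y : R => y + b) x.
  apply: (@raff_eq _ (fun y => n%:R ^ 0 * y + b) _ 1) => //; last exact: raff_affine.
  by move=> y _; rewrite expr0z mul1r.
have id_reg x : reg n (fun y : R => y) x.
  apply: (@reg_eq _ (fun y => n%:R ^ 0 * y + 0) _ 1) => //; last exact: reg_affine.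
  by move=> y _; rewrite expr0z mul1r addr0.
have sh_reg b x : reg n (fun y : R => y + b) x.
  apply: (@reg_eq _ (fun y => n%:R ^ 0 * y + b) _ 1) => //; last exact: reg_affine.
  by move=> y _; rewrite expr0z mul1r.
apply: (@G_intro _ (rotation (r%:R - a)) [set r%:R - a]).
- exact: rotationK.
- by move=> x; rewrite -{1}[a](subKr r%:R) rotationK.
- by move=> x; exact: rotation_in.
- by move=> x; exact: rotation_in.
- move=> x; rewrite negb_and -ltNge -leNgt /rotation => /orP[->//|rx].
  by rewrite [x < r%:R]ltNge rx; case: ifP.
- by move=> x _; do !apply: raff_if.
- exact: finite_set1.
- by move=> _ ->.
- move=> x x0r xS; apply: reg_if => //; first by apply/eqP; lra.
  apply: reg_if => //; first by apply/eqP; lra.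
  by apply: reg_if => //; apply/eqP.
- by move=> x; exact: nd.
- by move=> x; exact: nd.
Qed.

(** For m = n ^ M this has slope 1 / m up to m * c, slope 1 up to r - c, and
    slope m after that.  It squeezes [0, m * c[ onto [0, c[. *)
Definition dilation (c m : R) x :=
  if x < 0 then x else if x < r%:R then
    (if x < m * c then x / m else
     if x < r%:R - c then x + (c - m * c) else r%:R - m * (r%:R - x))
  else x.

(** The inverse of dilation c m. *)
Definition contraction (c m : R) x :=
  if x < 0 then x else if x < r%:R then
    (if x < c then m * x else
     if x < r%:R - m * c then x + (m * c - c) else r%:R - (r%:R - x) / m)
  else x.

Lemma dilation_outside c m x : ~~ (0 <= x < r%:R) ->
  dilation c m x = x /\ contraction c m x = x.
Proof.
rewrite negb_and -ltNge -leNgt /dilation /contraction => /orP[->//|rx].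
by rewrite (ltNge x r%:R) rx /=; case: ifP.
Qed.

Section Dilation.
Variables (c m : R) (M : nat).
Hypotheses (mE : m = n%:R ^+ M) (c_ge0 : 0 <= c) (mc : c + m * c <= r%:R).
Let m_gt0 : 0 < m. Proof. by rewrite mE exprn_gt0// ltr0n. Qed.
Let m_ge1 : 1 <= m.
Proof. by rewrite mE -natrX ler1n expn_gt0 n_gt0. Qed.
Let mVm x : m * (x / m) = x.
Proof. by rewrite mulrCA divff ?mulr1// lt0r_neq0. Qed.
Let mu_ge0 x : 0 <= x -> 0 <= x / m.
Proof. by move=> x0; rewrite divr_ge0// ltW. Qed.

Let pm x : 0 <= x -> 0 <= m * x.
Proof. by move=> x0; rewrite mulr_ge0// ltW. Qed.
Let pml x : 0 < x -> 0 < m * x.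
Proof. by move=> x0; rewrite mulr_gt0. Qed.
Let cm : c <= m * c.
Proof. by rewrite ler_peMl. Qed.
Let divm_lt x y : x < m * y -> x / m < y.
Proof. by rewrite ltr_pdivrMr// mulrC. Qed.
Let divm_le x y : x <= m * y -> x / m <= y.
Proof. by rewrite ler_pdivrMr// mulrC. Qed.

Let facts : [/\ 0 <= c, c + m * c <= r%:R, c <= m * c, 0 < m & 1 <= m].
Proof. by split. Qed.

Lemma dilation_bounds x : 0 <= x < r%:R ->
  [/\ 0 <= dilation c m x < r%:R & 0 <= contraction c m x < r%:R].
Proof.
have [c0 mc' cm' m0 m1] := facts.
move=> /andP[x0 xr]; rewrite /dilation /contraction ltNge x0 /= xr.
have xr0 : 0 < r%:R - x by rewrite subr_gt0.
split.
  have [xm|mx] := ltP x (m * c); first by have := divm_lt xm; have := mu_ge0 x0; lra.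
  have [xc|cx] := ltP x (r%:R - c); first by lra.
  have := pml xr0; have : 0 <= m * (x - (r%:R - c)) by rewrite pm// subr_ge0.
  by lra.
have [xm|mx] := ltP x c.
  have := pm x0; have : 0 < m * (c - x) by rewrite pml// subr_gt0.
  by lra.
have [xc|cx] := ltP x (r%:R - m * c); first by lra.
have : (r%:R - x) / m <= c by apply: divm_le; lra.
have : 0 < (r%:R - x) / m by rewrite divr_gt0.
by lra.
Qed.

Lemma dilationK : cancel (dilation c m) (contraction c m).
Proof.
have [c0 mc' cm' m0 m1] := facts.
move=> x; have [x0r|] := boolP (0 <= x < r%:R); last first.
  by move=> /(dilation_outside c m)[-> ->].
have [/andP[h0 hr] _] := dilation_bounds x0r.
rewrite /contraction ltNge h0 /= hr.
move: h0 hr; case/andP: x0r => x0 xr.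
rewrite /dilation ltNge x0 /= xr.
have [xm|mx] := ltP x (m * c).
  by move=> _ _; rewrite ltr_pdivrMr// [c * m]mulrC xm mVm.
have [xc|cx] := ltP x (r%:R - c).
  by move=> h0 hr; do !case: ifP; lra.
have xr0 : 0 <= m * (x - (r%:R - c)) by rewrite pm// subr_ge0.
move=> h0 hr; rewrite ifF; last by apply/negP => ?; lra.
rewrite ifF; last by apply/negP => ?; lra.
by rewrite subKr mulrAC divff ?mul1r ?subKr// lt0r_neq0.
Qed.

Lemma contractionK : cancel (contraction c m) (dilation c m).
Proof.
have [c0 mc' cm' m0 m1] := facts.
move=> x; have [x0r|] := boolP (0 <= x < r%:R); last first.
  by move=> /(dilation_outside c m)[E E']; rewrite E' E.
have [_ /andP[h0 hr]] := dilation_bounds x0r.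
rewrite /dilation ltNge h0 /= hr.
move: h0 hr; case/andP: x0r => x0 xr.
rewrite /contraction ltNge x0 /= xr.
have [xm|mx] := ltP x c.
  by move=> _ _; rewrite ltr_pM2l// xm mulrAC divff ?mul1r// lt0r_neq0.
have [xc|cx] := ltP x (r%:R - m * c).
  by move=> h0 hr; do !case: ifP; lra.
have := mVm (r%:R - x) => E.
move=> h0 hr; rewrite ifF; last by apply/negP => ?; nra.
rewrite ifF; last by apply/negP => ?; nra.
by rewrite subKr E subKr.
Qed.

Lemma dilation_raff x : raff n (dilation c m) x.
Proof.
rewrite /dilation /=; do !apply: raff_if.
- by have := raff_affine 0 0 x; apply: raff_eq ltr01 _ => y _; rewrite expr0z; ring.
- have := raff_affine (- Posz M) 0 x; apply: raff_eq ltr01 _ => y _.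
  by rewrite -invr_expz addr0 mulrC mE.
- by have := raff_affine 0 (c - m * c) x; apply: raff_eq ltr01 _ => y _; rewrite expr0z; ring.
- have := raff_affine (Posz M) (r%:R - m * r%:R) x; apply: raff_eq ltr01 _ => y _.
  by rewrite -exprnP mE; ring.
- by have := raff_affine 0 0 x; apply: raff_eq ltr01 _ => y _; rewrite expr0z; ring.
Qed.

Lemma dilation_reg x : 0 < x < r%:R -> x != m * c -> x != r%:R - c ->
  reg n (dilation c m) x.
Proof.
move=> x0r xm xc; rewrite /dilation /=.
apply: reg_if; first by apply/eqP; lra.
  by have := reg_affine 0 0 x; apply: reg_eq ltr01 _ => y _; rewrite expr0z; ring.
apply: reg_if; first by apply/eqP; lra.
  apply: reg_if => //.
    have := reg_affine (- Posz M) 0 x; apply: reg_eq ltr01 _ => y _.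
    by rewrite -invr_expz addr0 mulrC mE.
  apply: reg_if => //.
    by have := reg_affine 0 (c - m * c) x; apply: reg_eq ltr01 _ => y _; rewrite expr0z; ring.
  have := reg_affine (Posz M) (r%:R - m * r%:R) x; apply: reg_eq ltr01 _ => y _.
  by rewrite -exprnP mE; ring.
by have := reg_affine 0 0 x; apply: reg_eq ltr01 _ => y _; rewrite expr0z; ring.
Qed.

Hypothesis cZ : nadic n c.

Lemma dilation_breaks : finite_set [set m * c; r%:R - c] /\
  [set m * c; r%:R - c] `<=` nadic n.
Proof.
have [c0 mc' cm' m0 m1] := facts.
split; first by rewrite finite_setU; split; exact: finite_set1.
move=> _ [] ->; first by rewrite mE; exact: nadicMn.
apply: nadicB => //; last exact: nadic_nat.
by nra.
Qed.

Lemma dilation_G : G_set n r (dilation c m).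
Proof.
have [c0 mc' cm' m0 m1] := facts.
have mcZ : nadic n (m * c) by rewrite mE; exact: nadicMn.
have [fS SZ] := dilation_breaks.
apply: (@G_intro _ (contraction c m) [set m * c; r%:R - c]) => //.
- exact: dilationK.
- exact: contractionK.
- by move=> x /dilation_bounds[].
- by move=> x /dilation_bounds[].
- by move=> x /(dilation_outside c m)[].
- by move=> x _; exact: dilation_raff.
- by move=> x x0r /not_orP[/eqP xm /eqP xc]; exact: dilation_reg.
- move=> x /andP[x0 xr] xZ; rewrite /dilation ltNge x0 /= xr.
  have [xm|mx] := ltP; first by rewrite mE; exact: nadicVn.
  have [xc|cx] := ltP.
    rewrite addrA; apply: nadicB => //; last exact: nadicD.
    by lra.
  apply: nadicB => //; [by nra| |exact: nadic_nat].
  by rewrite mE; apply: nadicMn; apply: nadicB => //; [exact: ltW|exact: nadic_nat].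
- move=> x /andP[x0 xr] xZ; rewrite /contraction ltNge x0 /= xr.
  have [xm|mx] := ltP; first by rewrite mE; exact: nadicMn.
  have [xc|cx] := ltP.
    apply: nadicD => //; exact: nadicB.
  have := mVm (r%:R - x) => E.
  apply: nadicB => //; [by nra| |exact: nadic_nat].
  by rewrite mE; apply: nadicVn; apply: nadicB => //; [exact: ltW|exact: nadic_nat].
Qed.

Lemma dilation_F : F_set n r (dilation c m).
Proof.
have [c0 mc' cm' m0 m1] := facts.
have [fS SZ] := dilation_breaks.
have hr : dilation c m r%:R = r%:R.
  by rewrite /dilation ltxx ltNge ler0n.
have gr : contraction c m r%:R = r%:R.
  by rewrite /contraction ltxx ltNge ler0n.
have bnd x : 0 <= x <= r%:R ->
    0 <= dilation c m x <= r%:R /\ 0 <= contraction c m x <= r%:R.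
  rewrite le_eqVlt [x <= _]le_eqVlt => /andP[x0 /orP[/eqP ->|xr]].
    by rewrite hr gr lexx ler0n.
  have [|] := @dilation_bounds x; first by move: x0; rewrite xr -le_eqVlt => ->.
  by split; lra.
have hb : set_bij `[0, r%:R] `[0, r%:R] (dilation c m).
  split=> [x|x y _ _ /(can_inj dilationK)//|y].
    by rewrite /= !in_itv/= => /bnd[].
  rewrite /= in_itv/= => /bnd[_ gy]; exists (contraction c m y).
    by rewrite /= in_itv.
  exact: contractionK.
have hm : {in `[0, r%:R] &, {homo dilation c m : x y / x < y}}.
  move=> x y; rewrite !in_itv/= => /andP[x0 xr] /andP[y0 yr] xy.
  have xr' : x < r%:R by lra.
  rewrite /dilation !ltNge x0 y0 /= -!ltNge xr'.
  have xyu : x / m < y / m by rewrite ltr_pM2r// invr_gt0.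
  have := mVm y; have := mVm x; have := mu_ge0 x0; have := mu_ge0 y0.
  have [yr'|ry] := ltP y r%:R.
    by do !case: ifP; nra.
  by do !case: ifP; nra.
have [_ _ hc] := homo_cont hb hm.
split=> //.
  apply: (nadic_PL_intro fS) => [x _|x x0r /not_orP[/eqP xm /eqP xc]].
    exact: SZ.
  exact: dilation_reg.
move=> x; rewrite in_itv/= negb_and -!ltNge /dilation => /orP[->//|rx].
by rewrite [x < r%:R]ltNge (ltW rx); case: ifP.
Qed.

End Dilation.
End PiecewiseAffine.

(** * Flexibility of G_{n,r} *)

Section Regions.
Variables (R : realType) (n r : nat).
Hypothesis n_gt0 : (0 < n)%N.
Implicit Types (h g : R -> R) (x y a b : R) (P Q : set R).

Definition base : set R := [set x | 0 <= x < r%:R].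

(** The finite unions of intervals [a, b[ with n-adic end points, described by
    local constancy of the indicator function.  In this form they are visibly
    stable under Boolean operations and under preimages by elements of the
    group, and no list of intervals has to be maintained. *)
Definition is_region Q :=
  [/\ Q `<=` base,
      forall x, base x -> exists2 d, 0 < d &
        forall y, x <= y < x + d -> (Q y <-> Q x) &
      exists S, [/\ finite_set S, S `<=` nadic n &
        forall x, 0 < x < r%:R -> ~ S x -> exists2 d, 0 < d &
          forall y, `|y - x| < d -> (Q y <-> Q x)]].

Lemma is_region_base : is_region base.
Proof.
split=> // [x /andP[x0 xr]|].
  exists (r%:R - x); first by rewrite subr_gt0.
  by move=> y xy; rewrite /base /=; split=> _; lra.
exists set0; split=> [|//|x /andP[x0 xr] _]; first exact: finite_set0.
exists (Num.min x (r%:R - x)); first by rewrite lt_min x0 subr_gt0.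
move=> y; rewrite lt_min !ltr_norml => /andP[y1 y2].
by rewrite /base /=; split=> _; lra.
Qed.

Lemma is_region_op (op : Prop -> Prop -> Prop) P Q :
  (forall A A' B B' : Prop, (A <-> A') -> (B <-> B') -> op A B <-> op A' B') ->
  [set x | op (P x) (Q x)] `<=` base -> is_region P -> is_region Q ->
  is_region [set x | op (P x) (Q x)].
Proof.
move=> opP sub [_ P1 [S [fS SZ P2]]] [_ Q1 [S' [fS' SZ' Q2]]]; split=> //.
  move=> x Dx; have [d d0 Pd] := P1 x Dx; have [e e0 Qe] := Q1 x Dx.
  exists (Num.min d e); first by rewrite lt_min d0.
  move=> y /andP[xy]; rewrite -ltrBlDl lt_min !ltrBlDl => /andP[yd ye].
  by apply: opP; [apply: Pd|apply: Qe]; rewrite xy.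
exists (S `|` S'); split.
- by rewrite finite_setU.
- by move=> x [/SZ|/SZ'].
move=> x x0r /not_orP[nS nS'].
have [d d0 Pd] := P2 x x0r nS; have [e e0 Qe] := Q2 x x0r nS'.
exists (Num.min d e); first by rewrite lt_min d0.
by move=> y; rewrite lt_min => /andP[yd ye]; apply: opP; [exact: Pd|exact: Qe].
Qed.

Lemma is_regionU P Q : is_region P -> is_region Q -> is_region (P `|` Q).
Proof.
move=> rP rQ; apply: (@is_region_op or) => //; first by tauto.
by have [sP _ _] := rP; have [sQ _ _] := rQ; move=> x [/sP|/sQ].
Qed.

Lemma is_regionB P Q : is_region P -> is_region Q -> is_region (P `\` Q).
Proof.
move=> rP rQ; apply: (@is_region_op (fun A B => A /\ ~ B)) => //; first by tauto.
by have [sP _ _] := rP; move=> x [/sP].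
Qed.

Lemma near_side x y a : `|y - x| < `|x - a| -> (a <= y) = (a <= x).
Proof.
rewrite ltr_norml; have [ax|xa] := leP a x.
  by rewrite [`|x - a|]ger0_norm ?subr_ge0// => h; apply/idP; lra.
by rewrite [`|x - a|]ltr0_norm ?subr_lt0// => h; apply/negP/negP; rewrite -ltNge; lra.
Qed.

Lemma is_region_itv a b : 0 <= a -> b <= r%:R -> nadic n a -> nadic n b ->
  is_region [set x | a <= x < b].
Proof.
move=> a0 br aZ bZ; split.
- by move=> x; rewrite /base /=; lra.
- move=> x _; have [xb|bx] := ltP x b; last by exists 1 => //= y yx; split; lra.
  have [ax|xa] := leP a x.
    by exists (b - x); [rewrite subr_gt0|move=> y yx /=; split; lra].
  by exists (a - x); [rewrite subr_gt0|move=> y yx /=; split; lra].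
exists [set a; b]; split.
- by rewrite finite_setU; split; exact: finite_set1.
- by move=> _ [] ->.
move=> x _ /not_orP[/eqP xa /eqP xb].
exists (Num.min `|x - a| `|x - b|).
  by rewrite lt_min !normr_gt0 !subr_eq0 xa.
move=> y; rewrite lt_min => /andP[ya yb] /=.
by rewrite (near_side ya) !ltNge (near_side yb).
Qed.

Lemma is_region_preimage g Q : G_set n r g -> is_region Q ->
  is_region (base `&` g @^-1` Q).
Proof.
move=> Gg [sQ Q1 [S [fS SZ Q2]]]; have [gb gc gPL gZ gid] := Gg.
have [fg gS _] := gPL; have [gD _ _] := gb; have gI := fix_inj gb gid.
have bg x : base x -> base (g x).
  by move=> Dx; have := gD x; rewrite /= !in_itv/=; apply.
have nb x : x \in `[0, r%:R[ -> base x by rewrite in_itv.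
have bn x : base x -> x \in `[0, r%:R[ by rewrite in_itv.
have [_ db1 [Sb [fSb SbZ db2]]] := is_region_base.
split; first by move=> x [].
  move=> x Dx; have [k [d d0 gk]] := G_raff Gg (bn x Dx).
  have [e e0 Qe] := Q1 _ (bg _ Dx).
  have [d' d'0 Dd'] := db1 x Dx.
  have nk : 0 < n%:R ^ k :> R by rewrite exprz_gt0 ?ltr0n.
  exists (Num.min (Num.min d d') (e / n%:R ^ k)); first by rewrite !lt_min d0 d'0 divr_gt0.
  move=> y /andP[xy]; rewrite -ltrBlDl !lt_min ltr_pdivlMr// !(ltrBlDl _ x) => /andP[/andP[yd yd'] ye].
  have gy : g y = g x + n%:R ^ k * (y - x) by apply: gk; rewrite xy.
  have Dy : base y by apply/Dd'; rewrite ?xy.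
  have QQ : Q (g y) <-> Q (g x).
    apply: Qe; rewrite gy lerDl ltrD2l mulrC ye andbT.
    by rewrite mulr_ge0 ?subr_ge0// ltW.
  by split=> -[_ /= Qx]; split=> //; apply/QQ.
exists (((singularities r g `|` (g @^-1` (S `|` [set 0]) `&` base))) `|` Sb); split.
- rewrite finite_setU; split=> //; rewrite finite_setU; split=> //.
  apply: finite_setIl; apply: finite_preimage.
    by move=> x y _ _ /gI.
  by rewrite finite_setU; split=> //; exact: finite_set1.
- move=> x [[/gS//|[Sgx /bn Dx]]|/SbZ//]; apply: (G_nadic Gg Dx).1.
  by case: Sgx => [/SZ//|->]; exact: nadic0.
move=> x x0r /not_orP[/not_orP[nx nS] nSb].
have Dx : base x by rewrite /base /=; lra.
have gx : ~ (S `|` [set 0]) (g x) by move=> gx; apply: nS.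
have [k [d d0 gk]] := nadic_PL_reg gPL x0r nx.
have := bg _ Dx; rewrite /base /= => /andP[gx0 gxr].
have gx1 : 0 < g x < r%:R.
  rewrite gxr andbT lt_neqAle gx0 andbT eq_sym; apply/eqP => E.
  by apply: gx; right.
have [|e e0 Qe] := Q2 (g x) gx1; first by move=> ?; apply: gx; left.
have [d' d'0 Dd'] := db2 x x0r nSb.
have nk : 0 < n%:R ^ k :> R by rewrite exprz_gt0 ?ltr0n.
exists (Num.min (Num.min d d') (e / n%:R ^ k)); first by rewrite !lt_min d0 d'0 divr_gt0.
move=> y; rewrite !lt_min ltr_pdivlMr// => /andP[/andP[yd yd'] ye].
have Dy : base y by apply/Dd'.
have QQ : Q (g y) <-> Q (g x).
  apply: Qe; rewrite gk// addrAC subrr add0r normrM gtr0_norm//.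
  by rewrite mulrC.
by split=> -[_ /= Qx]; split=> //; apply/QQ.
Qed.

Hypothesis n_gt1 : (1 < n)%N.

Lemma small_cell x (d : R) : 0 <= x -> 0 < d -> exists K, forall k, (K <= k)%N ->
  exists p : nat, x <= p%:R / n%:R ^+ k /\ p.+1%:R / n%:R ^+ k < x + d.
Proof.
move=> x0 d0; exists (Num.truncn (2 / d)).+1 => k Kk.
have N0 : 0 < n%:R ^+ k :> R by rewrite exprn_gt0 ?ltr0n.
have Nd : 2 < n%:R ^+ k * d.
  rewrite -ltr_pdivrMr//; apply: lt_le_trans (truncnS_gt _) _.
  by rewrite -natrX ler_nat (leq_trans Kk)// ltnW// ltn_expl.
exists (Num.truncn (x * n%:R ^+ k)).+1.
have xN : 0 <= x * n%:R ^+ k by rewrite mulr_ge0// ltW.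
have /andP[t1 t2] := truncn_itv xN.
rewrite ler_pdivlMr// ltr_pdivrMr//; split; first exact: ltW.
rewrite mulrDl -addn1 natrD -(addn1 (Num.truncn _)) natrD.
by rewrite [d * _]mulrC; lra.
Qed.

(** The cells of all sufficiently fine levels are needed, since compression
    compares two cells of the same level.  The last clause leaves room in P. *)
Lemma cell_in_region P : is_region P -> P !=set0 -> exists K, forall k, (K <= k)%N ->
  exists p : nat, [/\ (p.+1%:R / n%:R ^+ k <= r%:R :> R),
    [set x | p%:R / n%:R ^+ k <= x < p.+1%:R / n%:R ^+ k] `<=` P &
    exists2 x, P x & p.+1%:R / n%:R ^+ k <= x].
Proof.
move=> [sP P1 _] [x Px]; have Dx := sP x Px; have [d d0 Pd] := P1 x Dx.
have d20 : 0 < d / 2 by rewrite divr_gt0.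
have x0 : 0 <= x by case/andP: Dx.
have [K cK] := small_cell x0 d20; exists K => k /cK[p [p1 p2]]; exists p.
have dr : P (x + d / 2) by apply/Pd => //; lra.
split.
- by have := sP _ dr; rewrite /base /=; lra.
- by move=> y /= yp; apply/Pd => //; lra.
- by exists (x + d / 2) => //; lra.
Qed.

Lemma is_region_cell (p k : nat) : p.+1%:R / n%:R ^+ k <= r%:R :> R ->
  is_region [set x | p%:R / n%:R ^+ k <= x < p.+1%:R / n%:R ^+ k].
Proof.
by move=> pr; apply: is_region_itv => //; exact: nadic_frac.
Qed.

Lemma cell_nonempty (p k : nat) :
  p%:R / n%:R ^+ k < p.+1%:R / n%:R ^+ k :> R.
Proof. by rewrite ltr_pM2r ?invr_gt0 ?exprn_gt0 ?ltr0n// ltr_nat. Qed.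

Notation G := (G_group R r n_gt0).
Definition evG (g : G) : R -> R := pg_fun g.

Lemma evGP (g : G) : G_set n r (evG g).
Proof. exact: (@pg_funP _ (G_perm R r n_gt0) g). Qed.

Lemma evG_onto h : G_set n r h -> exists g : G, evG g = h.
Proof. by move=> Gh; exists (@PgElt _ (G_perm R r n_gt0) h Gh). Qed.

Lemma evG1 x : evG 1%g x = x. Proof. by []. Qed.

Lemma evGM (g h : G) x : evG (g * h)%g x = evG g (evG h x). Proof. by []. Qed.

Lemma evGK (g : G) : cancel (evG g) (evG g^-1%g).
Proof. by move=> x; rewrite -evGM mulVg. Qed.

Lemma evGVK (g : G) : cancel (evG g^-1%g) (evG g).
Proof. by move=> x; rewrite -evGM mulgV. Qed.

Lemma evG_base (g : G) x : base x -> base (evG g x).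
Proof.
by have [[gD _ _] _ _ _ _] := evGP g; have := gD x; rewrite /= !in_itv.
Qed.

Lemma image_evG (g : G) Q : Q `<=` base ->
  evG g @` Q = base `&` evG g^-1%g @^-1` Q.
Proof.
move=> QD; apply/seteqP; split=> [_ [x Qx <-]|x [Dx Qx]].
  by split; [exact/evG_base/QD|rewrite /preimage /mkset evGK].
by exists (evG g^-1%g x) => //; rewrite evGVK.
Qed.

Lemma is_region_image (g : G) Q : is_region Q -> is_region (evG g @` Q).
Proof.
move=> rQ; have [QD _ _] := rQ; rewrite image_evG//.
by apply: is_region_preimage => //; exact: evGP.
Qed.

Lemma region_split P : is_region P -> P !=set0 ->
  exists Q, [/\ is_region Q, Q `<=` P, Q !=set0 & P `\` Q !=set0].
Proof.
move=> rP P0; have [K /(_ K (leqnn _))[p [pr pP [x Px px]]]] := cell_in_region rP P0.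
exists [set x | p%:R / n%:R ^+ K <= x < p.+1%:R / n%:R ^+ K]; split=> //.
- exact: is_region_cell.
- by exists (p%:R / n%:R ^+ K); rewrite /= lexx cell_nonempty.
- by exists x; split=> //= ; lra.
Qed.

Lemma region_displace (g : G) : g <> 1%g ->
  exists P, [/\ is_region P, P !=set0 & forall x, P x -> ~ P (evG g x)].
Proof.
move=> g1; have [_ _ _ _ gid] := evGP g.
have [x gx] : exists x, evG g x <> x.
  by apply: contrapT => H; apply: g1; apply: pg_eq => x; apply: contrapT => gx; apply: H; exists x.
have Dx : base x.
  by apply: contrapT => /negP nD; apply: gx; apply: gid; rewrite in_itv.
have Dx' : x \in `[0, r%:R[ by rewrite in_itv.
have [k [d d0 gk]] := G_raff (evGP g) Dx'.
have nk : 0 < n%:R ^ k :> R by rewrite exprz_gt0 ?ltr0n.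
have [e e0 eE] : exists2 e, 0 < e & e * 2 = `|evG g x - x|.
  exists (`|evG g x - x| / 2); last by rewrite divfK.
  by rewrite divr_gt0// normr_gt0 subr_eq0; apply/eqP.
case/andP: Dx => x0 xr.
pose d' := Num.min (Num.min d (r%:R - x)) (Num.min e (e / n%:R ^ k)).
have d'0 : 0 < d' by rewrite !lt_min d0 subr_gt0 xr e0 divr_gt0.
have [K /(_ K (leqnn _))[p [p1 p2]]] := small_cell x0 d'0.
have pd (a : R) : x + d' <= a -> p.+1%:R / n%:R ^+ K < a by exact: lt_le_trans.
exists [set x | p%:R / n%:R ^+ K <= x < p.+1%:R / n%:R ^+ K]; split.
- apply: is_region_cell; apply/ltW/pd; rewrite -lerBrDl.
  by rewrite /d' !ge_min lexx orbT.
- by exists (p%:R / n%:R ^+ K); rewrite /= lexx cell_nonempty.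
have pe y : p%:R / n%:R ^+ K <= y < p.+1%:R / n%:R ^+ K ->
    [/\ x <= y, y < x + d, y < x + e & n%:R ^ k * (y - x) < e].
  move=> /andP[y1 y2]; have yx : x <= y by lra.
  have : y - x < d' by rewrite ltrBlDl; apply: lt_trans y2 p2.
  rewrite !lt_min ltr_pdivlMr// => /andP[/andP[h1 _] /andP[h3 h4]].
  by split=> //; [lra|lra|rewrite mulrC].
move=> y /= /pe[xy yd ye kye] /pe[gxy _ gye _].
have gy : evG g y = evG g x + n%:R ^ k * (y - x) by apply: gk; rewrite xy.
have := mulr_ge0 (ltW nk) (_ : 0 <= y - x); rewrite subr_ge0 => /(_ xy) kyx.
move: eE; case: (leP 0 (evG g x - x)) => [h|h].
  by rewrite ger0_norm//; lra.
by rewrite ltr0_norm//; lra.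
Qed.

Lemma region_swap (g : G) Q : is_region Q -> (forall x, Q x -> ~ Q (evG g x)) ->
  exists s : G, (forall x, Q x -> evG s x = evG g x) /\
    (forall x, ~ Q x -> ~ (evG g @` Q) x -> evG s x = x).
Proof.
move=> rQ Qg; pose Q' := evG g @` Q; pose g' := evG g^-1%g.
have rQ' : is_region Q' by exact: is_region_image.
have [QD Q1 [S [fS SZ Q2]]] := rQ; have [Q'D Q'1 [S' [fS' SZ' Q'2]]] := rQ'.
pose s x := if `[< Q x >] then evG g x else if `[< Q' x >] then g' x else x.
have sQ x : Q x -> s x = evG g x by move=> Qx; rewrite /s asboolT.
have QQ' x : Q x -> ~ Q' x by move=> Qx [y /Qg + yx]; rewrite yx.
have sQ' x : Q' x -> s x = g' x.
  by move=> Q'x; rewrite /s asboolF ?asboolT// => /QQ'.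
have sN x : ~ Q x -> ~ Q' x -> s x = x by move=> nQ nQ'; rewrite /s !asboolF.
have ss : cancel s s.
  move=> x; have [Qx|nQ] := pselect (Q x).
    by rewrite (sQ _ Qx) sQ' ?/g' ?evGK//; exists x.
  have [[y Qy yx]|nQ'] := pselect (Q' x); last by rewrite !sN.
  by rewrite (sQ' x); [rewrite -yx /g' evGK sQ|exists y].
have sD x : base x -> base (s x).
  move=> Dx; have [Qx|nQ] := pselect (Q x); first by rewrite sQ//; exact: evG_base.
  have [Q'x|nQ'] := pselect (Q' x); last by rewrite sN.
  by rewrite sQ'//; exact: evG_base.
have sZ x : base x -> nadic n x -> nadic n (s x).
  move=> Dx xZ; have Dx' : x \in `[0, r%:R[ by rewrite in_itv.
  have [Qx|nQ] := pselect (Q x); first by rewrite sQ//; apply: (G_nadic (evGP _) Dx').2.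
  have [Q'x|nQ'] := pselect (Q' x); last by rewrite sN.
  by rewrite sQ'//; apply: (G_nadic (evGP _) Dx').2.
have [_ _ gPL _ _] := evGP g; have [_ _ g'PL _ _] := evGP g^-1%g.
have [fg gS _] := gPL; have [fg' g'S _] := g'PL.
have id_raff x : raff n (fun y : R => y) x.
  apply: (@raff_eq _ _ _ (fun y => n%:R ^ 0 * y + 0) _ 1) => //; last exact: raff_affine.
  by move=> y _; rewrite expr0z mul1r addr0.
have id_reg x : reg n (fun y : R => y) x.
  apply: (@reg_eq _ _ _ (fun y => n%:R ^ 0 * y + 0) _ 1) => //; last exact: reg_affine.
  by move=> y _; rewrite expr0z mul1r addr0.
have Gs : G_set n r s.
  apply: (@G_intro _ _ _ _ s ((S `|` S') `|` (singularities r (evG g) `|` singularities r g'))) => //.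
  - move=> x nD; apply: sN; first by move=> /QD; apply/negP.
    by move=> /Q'D; apply/negP.
  - move=> x Dx; have Dx' : x \in `[0, r%:R[ by rewrite in_itv.
    have [d d0 Qd] := Q1 x Dx; have [e e0 Qe] := Q'1 x Dx.
    have [Qx|nQ] := pselect (Q x).
      by apply: (raff_eq d0 _ (G_raff (evGP g) Dx')) => y /Qd Qy; rewrite sQ//; apply/Qy.
    have [Q'x|nQ'] := pselect (Q' x).
      by apply: (raff_eq e0 _ (G_raff (evGP g^-1%g) Dx')) => y /Qe Qy; rewrite sQ'//; apply/Qy.
    apply: (@raff_eq _ _ _ (fun y => y) _ (Num.min d e)) => //; first by rewrite lt_min d0.
    move=> y /andP[xy]; rewrite -ltrBlDl lt_min !ltrBlDl => /andP[yd ye].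
    by apply: sN => Qy; [apply/nQ/(Qd y)|apply/nQ'/(Qe y)] => //; rewrite xy.
  - by rewrite !finite_setU.
  - by move=> x [[/SZ|/SZ']|[/gS|/g'S]].
  move=> x x0r /not_orP[/not_orP[nS nS'] /not_orP[ng ng']].
  have [d d0 Qd] := Q2 x x0r nS; have [e e0 Qe] := Q'2 x x0r nS'.
  have [Qx|nQ] := pselect (Q x).
    by apply: (reg_eq d0 _ (nadic_PL_reg gPL x0r ng)) => y /Qd Qy; rewrite sQ//; apply/Qy.
  have [Q'x|nQ'] := pselect (Q' x).
    by apply: (reg_eq e0 _ (nadic_PL_reg g'PL x0r ng')) => y /Qe Qy; rewrite sQ'//; apply/Qy.
  apply: (@reg_eq _ _ _ (fun y => y) _ (Num.min d e)) => //; first by rewrite lt_min d0.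
  move=> y; rewrite lt_min => /andP[yd ye].
  by apply: sN => Qy; [apply/nQ/(Qd y)|apply/nQ'/(Qe y)].
have [t tE] := evG_onto Gs; exists t; rewrite tE; split=> // x; exact: sN.
Qed.

(** Q avoids a cell, which one rotation moves to the right end of [0, r[.  A
    dilation squeezes the complement of that end into the first cell, and a
    second rotation carries the first cell into P. *)
Lemma region_compress P Q : is_region P -> is_region Q -> P !=set0 ->
  base `\` Q !=set0 -> exists g : G, evG g @` Q `<=` P.
Proof.
move=> rP rQ P0 DQ0; have rDQ := is_regionB is_region_base rQ.
have [K1 cP] := cell_in_region rP P0; have [K2 cQ] := cell_in_region rDQ DQ0.
pose k := maxn K1 K2.
have [q [qr qP _]] := cP k (leq_maxl _ _).
have [p [pr pQ _]] := cQ k (leq_maxr _ _).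
have QD : Q `<=` base by case: rQ.
have N0 : 0 < n%:R ^+ k :> R by rewrite exprn_gt0 ?ltr0n.
pose u : R := 1 / n%:R ^+ k.
have u0 : 0 < u by rewrite divr_gt0.
have cellE (i : nat) : i.+1%:R / n%:R ^+ k = i%:R / n%:R ^+ k + u :> R.
  by rewrite /u -mulrDl natr1.
have frac0 (i : nat) : 0 <= i%:R / n%:R ^+ k :> R.
  by rewrite divr_ge0 ?ler0n// ltW.
have p0 := frac0 p; have q0 := frac0 q; rewrite !cellE in qr pr qP pQ.
set pk := p%:R / n%:R ^+ k in p0 pr pQ; set qk := q%:R / n%:R ^+ k in q0 qr qP.
have uZ : nadic n u by exact: (nadic_frac R n 1).
pose M := (Num.truncn (r%:R / u : R)).+1.
have m0 : 0 < n%:R ^+ M :> R by rewrite exprn_gt0 ?ltr0n.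
have mru : r%:R / n%:R ^+ M < u.
  rewrite ltr_pdivrMr// mulrC -ltr_pdivrMr//; apply: lt_le_trans (truncnS_gt _) _.
  by rewrite -natrX ler_nat ltnW// ltn_expl.
(* The dilation has to squeeze all but the last cell, of length m * c = r - u,
   into less than one cell. *)
pose c := (r%:R - u) / n%:R ^+ M.
have ru : u <= r%:R by lra.
have rZ := @nadic_nat R n r.
have cZ : nadic n c by apply: nadicVn => //; exact: nadicB.
have c0 : 0 <= c by rewrite divr_ge0 ?subr_ge0// ltW.
have mcE : n%:R ^+ M * c = r%:R - u by rewrite mulrC divfK// gt_eqF.
have cu : c < u.
  by apply: le_lt_trans mru; rewrite ler_pM2r ?invr_gt0//; lra.
have mc : c + n%:R ^+ M * c <= r%:R by rewrite mcE; lra.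
have pa : 0 <= r%:R - (pk + u) <= r%:R by lra.
have qb : 0 <= qk <= r%:R by lra.
have pkZ : nadic n (r%:R - (pk + u)).
  by apply: nadicB => //; apply: nadicD => //; exact: nadic_frac.
have [g1 g1E] := evG_onto (rotation_G n_gt0 pa pkZ).
have [g2 g2E] := evG_onto (dilation_G n_gt0 (erefl _) c0 mc cZ).
have [g3 g3E] := evG_onto (rotation_G n_gt0 qb (nadic_frac R n q k)).
exists (g3 * (g2 * g1))%g => _ [x Qx <-].
rewrite !evGM g1E g2E g3E.
have /andP[x0 xr] := QD _ Qx.
have nx : ~~ (pk <= x < pk + u) by apply/negP => /pQ[].
have /andP[y0 yr] : 0 <= rotation r (r%:R - (pk + u)) x < r%:R - u.
  rewrite /rotation ltNge x0 /= xr subKr.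
  case: ifP => [xp|]; last by lra.
  by move: nx; rewrite xp andbT -ltNge; lra.
have yr' : rotation r (r%:R - (pk + u)) x < r%:R by lra.
have /andP[z0 zc] : 0 <= dilation r c (n%:R ^+ M) (rotation r (r%:R - (pk + u)) x) < c.
  rewrite /dilation ltNge y0 /= yr' mcE yr divr_ge0 ?(ltW m0)//=.
  by rewrite ltr_pM2r ?invr_gt0.
apply: qP; set z := dilation _ _ _ _ in z0 zc *.
have zr : z < r%:R by lra.
rewrite /= /rotation ltNge z0 /= zr ifT; last by lra.
by apply/andP; split; lra.
Qed.

Theorem G_flexible : flexible evG base is_region.
Proof.
split.
- exact: evG1.
- exact: evGM.
- exact: evG_base.
- exact: is_region_base.
- by move=> P [].
- exact: is_regionU.
- exact: is_regionB.
- exact: is_region_image.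
- exact: region_split.
- exact: region_compress.
- exact: region_swap.
- exact: region_displace.
Qed.

End Regions.

(** * Countability of G_{n,r} *)

Section Countability.
Variables (R : realType) (n r : nat).
Hypothesis n_gt0 : (0 < n)%N.
Implicit Types (h : R -> R) (x y b : R).

Lemma affine_between h x b : nadic_PL n r h -> raff n h x ->
  0 <= x < b -> b <= r%:R -> (forall y, x < y < b -> ~ singularities r h y) ->
  exists k : int, forall y, x <= y < b -> h y = h x + n%:R ^ k * (y - x).
Proof.
move=> hPL hx /andP[x0 xb] br nS.
have [|k hk] := reg_slope xb (h := h) (n := n).
  by move=> y yd; apply: nadic_PL_reg (nS _ yd) => //; lra.
exists k => y /andP[]; rewrite le_eqVlt => /orP[/eqP <-|xy yb].
  by rewrite subrr mulr0 addr0.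
suff E : h y - h x = n%:R ^ k * (y - x) by rewrite -E addrC subrK.
have hd w : w \in `]x, y[ -> is_derive w 1 h (n%:R ^ k).
  by rewrite in_itv /= => w1; apply/aff_derive/hk; lra.
apply: (MVT_lin xy hd); apply/(continuous_within_itvP _ xy); split.
- move=> w; rewrite in_itv /= => w1.
  by apply: (@aff_continuous _ _ _ (n%:R ^ k)); apply: hk; lra.
- exact: raff_cvg hx.
- have /hk/aff_continuous hy : x < y < b by rewrite xy.
  exact: cvg_at_left_filter.
Qed.

Definition decode (c : nat * nat) : R := c.1%:R / n%:R ^+ c.2.

(** The map described by a list of pieces (break point, value there, exponent of
    the slope), with the break points in decreasing order. *)
Fixpoint eval (s : seq ((nat * nat) * (nat * nat) * int)) y : R :=
  if s is (p, q, k) :: s' then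
    if decode p <= y then decode q + n%:R ^ k * (y - decode p) else eval s' y
  else y.

Lemma G_eval h : G_set n r h -> exists s, forall y, 0 <= y < r%:R -> h y = eval s y.
Proof.
move=> Gh; have [_ _ hPL _ _] := Gh; have [/finite_seqP[L LE] hS _] := hPL.
have piece x b : nadic n x -> 0 <= x < b -> b <= r%:R ->
    (forall y, x < y < b -> ~ singularities r h y) ->
    exists p q k, decode p = x /\
      forall y, x <= y < b -> h y = decode q + n%:R ^ k * (y - x).
  move=> xZ xb br nS; have Dx : x \in `[0, r%:R[ by rewrite in_itv/=; lra.
  have [k hk] := affine_between hPL (G_raff Gh Dx) xb br nS.
  have [q [l hE]] := (G_nadic Gh Dx).2 xZ; have [p [j xE]] := xZ.
  exists (p, j), (q, l), k; split=> // y /hk ->.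
  by rewrite hE.
pose L' := sort (fun x y => y <= x) L.
have sL' : sorted (fun x y => y <= x) L'.
  by apply: sort_sorted => x y; exact: le_total.
have LZ x : x \in L' -> nadic n x.
  by rewrite mem_sort => xL; apply: hS; rewrite LE.
have LS y : singularities r h y -> y \in L' by rewrite mem_sort LE.
(* Induction over the singularities, from the largest one downwards. *)
suff claim b : b <= r%:R -> (forall y, 0 < y < b -> singularities r h y -> y \in L') ->
    exists s, forall y, 0 <= y < b -> h y = eval s y.
  by apply: claim => // y _; exact: LS.
elim: L' sL' LZ b {LS} => [|p L' IH] sL' LZ b br bS.
  have [b0|b0] := leP b 0; first by exists [::] => y; lra.
  have [||y yb|p [q [k [p0 hk]]]] := piece 0 b _ _ br.
  - exact: nadic0.
  - by rewrite lexx.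
  - by move=> /(bS _ yb).
  - by exists [:: (p, q, k)] => y yb; rewrite /= p0; case/andP: (yb) => -> _; exact: hk.
have minp : all (fun y => y <= p) L'.
  by apply: order_path_min sL' => x y z xy yz; exact: le_trans yz xy.
have {}IH := IH (path_sorted sL') (fun x xL => LZ x (mem_behead (s := p :: L') xL)).
have [/andP[p0 pb]|np] := boolP (0 < p < b); last first.
  apply: IH => // y yb yS; have := bS y yb yS.
  by rewrite in_cons => /orP[/eqP yp|//]; move: np; rewrite -yp yb.
have [|y /andP[y0 yp] yS|s hs] := IH p.
- by lra.
- have : y \in p :: L' by apply: bS => //; lra.
  by rewrite in_cons (lt_eqF yp).
have pZ : nadic n p by apply: LZ; rewrite mem_head.
have [|y /andP[py yb] yS|p' [q [k [pE hk]]]] := piece p b pZ _ br.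
- by lra.
- have : y \in p :: L' by apply: bS => //; lra.
  rewrite in_cons (gt_eqF py) /= => /(allP minp).
  by rewrite leNgt py.
exists ((p', q, k) :: s) => y yb; rewrite /= pE; case: leP => py.
  by apply: hk; rewrite py; case/andP: yb.
by apply: hs; rewrite py; case/andP: yb => ->.
Qed.

Lemma G_countable : countable [set: G_group R r n_gt0].
Proof.
have /choice[s sP] : forall g : G_group R r n_gt0, exists s,
    forall y, 0 <= y < r%:R -> evG g y = eval s y.
  by move=> g; apply: G_eval; exact: evGP.
apply/countable_injP; exists (fun g => pickle (s g)) => g h _ _.
move=> /(pcan_inj pickleK) sgh; apply: pg_eq => y.
have [_ _ _ _ gid] := evGP g; have [_ _ _ _ hid] := evGP h.
have [yD|yD] := boolP (0 <= y < r%:R).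
  by have := sP g y yD; rewrite sgh -sP.
have := gid y; rewrite in_itv => /(_ yD) E.
by have := hid y; rewrite in_itv => /(_ yD) E'; rewrite [LHS]E [RHS]E'.
Qed.

End Countability.

(** * Germs at 0 in F_{n,r} *)

Section GermsAtZero.
Variables (R : realType) (n r : nat).
Hypotheses (n_gt0 : (0 < n)%N) (r_gt0 : (0 < r)%N).
Notation F := (F_group R r n_gt0).

Let evF (g : F) : R -> R := pg_fun g.

Let evFP (g : F) : F_set n r (evF g).
Proof. exact: (@pg_funP _ (F_perm R r n_gt0) g). Qed.

Let evFM (g h : F) x : evF (g * h)%g x = evF g (evF h x). Proof. by []. Qed.

Let evFK (g : F) : cancel (evF g) (evF g^-1%g).
Proof. by move=> x; rewrite -evFM mulVg. Qed.

Lemma F_linear_at0 h : F_set n r h -> exists (k : int) (d : R), 0 < d /\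
  forall y, 0 <= y < d -> h y = n%:R ^ k * y.
Proof.
move=> [hb hc hm hPL _]; have [h0 _ _] := homo_cont hb hm.
have r0 : 0 < r%:R :> R by rewrite ltr0n.
have [k [d d0 hk]] : raff n h 0.
  apply: PL_raff; [exact: hPL|by rewrite lexx|].
  by have [_ + _] := (continuous_within_itvP h r0).1 hc.
exists k, d; split=> // y yd; rewrite hk ?add0r//.
by rewrite h0 add0r subr0.
Qed.

Definition trivial_germ : set F :=
  [set g | exists2 d : R, 0 < d & forall y, 0 <= y < d -> evF g y = y].

Let linear_small (g : F) (d : R) : 0 < d -> exists2 e : R, 0 < e &
  forall y, 0 <= y < e -> 0 <= evF g y < d.
Proof.
move=> d0; have [k [e [e0 gk]]] := F_linear_at0 (evFP g).
have nk : 0 < n%:R ^ k :> R by rewrite exprz_gt0 ?ltr0n.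
exists (Num.min e (d / n%:R ^ k)); first by rewrite lt_min e0 divr_gt0.
move=> y /andP[y0]; rewrite lt_min ltr_pdivlMr// => /andP[ye yd].
by rewrite gk ?y0// mulrC yd mulr_ge0// ltW.
Qed.

Lemma trivial_germ_normal : normal_subgroup trivial_germ.
Proof.
split.
- by exists 1.
- move=> g h [d d0 gd] [e e0 he]; exists (Num.min d e); first by rewrite lt_min d0.
  move=> y /andP[y0]; rewrite lt_min => /andP[yd ye].
  by rewrite evFM he ?gd ?y0.
- by move=> g [d d0 gd]; exists d => // y yd; rewrite -{1}(gd y yd) evFK.
- move=> g h [d d0 gd]; have [e e0 he] := linear_small h d0.
  by exists e => // y ye; rewrite /conjg !evFM gd ?he// evFK.
Qed.

(** Near 0 all elements are linear, and linear maps commute. *)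
Lemma trivial_germ_commutator (g h : F) :
  trivial_germ (g^-1 * (h^-1 * (g * h)))%g.
Proof.
have [k [d [d0 gk]]] := F_linear_at0 (evFP g).
have [l [e [e0 hl]]] := F_linear_at0 (evFP h).
have [d' d'0 hd] := linear_small h d0; have [e' e'0 ge] := linear_small g e0.
exists (Num.min (Num.min d e) (Num.min d' e')); first by rewrite !lt_min d0 e0 d'0.
move=> y /andP[y0]; rewrite !lt_min => /andP[/andP[yd ye] /andP[yd' ye']].
have gh : evF g (evF h y) = evF h (evF g y).
  rewrite gk ?hd ?y0// [in RHS]hl ?ge ?y0// gk ?y0// hl ?y0//; ring.
by rewrite !evFM gh !evFK.
Qed.

(** The dilation with c = 1 / n ^ 2 and m = n has slope 1 / n at 0; here
    c + m * c = 1 / n ^ 2 + 1 / n <= 1. *)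
Lemma trivial_germ_proper : (1 < n)%N -> trivial_germ <> setT.
Proof.
move=> n1; have n0 : 0 < n%:R :> R by rewrite ltr0n.
have n2 : 2 <= n%:R :> R by rewrite (ler_nat R 2).
have r1 : 1 <= r%:R :> R by rewrite (ler_nat R 1).
pose c : R := 1 / n%:R ^+ 2.
have c0 : 0 < c by rewrite divr_gt0// exprn_gt0.
have ncE : n%:R ^+ 1 * c = n%:R^-1 :> R by rewrite /c; field; rewrite gt_eqF.
have cE : c = n%:R^-1 * n%:R^-1 by rewrite /c; field; rewrite gt_eqF.
have v0 : 0 < n%:R^-1 :> R by rewrite invr_gt0.
have v1 : n%:R^-1 <= 2^-1 :> R by rewrite lef_pV2 ?posrE.
have mc : c + n%:R ^+ 1 * c <= r%:R by rewrite ncE cE; nra.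
have hF := dilation_F n_gt0 (erefl _) (ltW c0) mc (nadic_frac R n 1 2).
move=> NT; have : trivial_germ (PgElt (P := F_perm R r n_gt0) hF) by rewrite NT.
move=> [d d0 fixd].
have [y [y0 yd yc]] : exists y, [/\ 0 < y, y < d & y <= c].
  exists (Num.min (d / 2) c); split; first by rewrite lt_min divr_gt0.
    by rewrite gt_min; apply/orP; left; lra.
  by rewrite ge_min lexx orbT.
have cv : c < n%:R^-1 by rewrite cE; nra.
have : y / n%:R ^+ 1 = y.
  rewrite -[RHS](fixd y); last by rewrite (ltW y0) yd.
  rewrite /evF /= /dilation ltNge (ltW y0) /=.
  by rewrite ifT ?ifT// ?ncE; lra.
by rewrite expr1; nra.
Qed.

End GermsAtZero.

(** * The groups with n = 1 *)

Section SlopeOne.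
Variables (R : realType) (r : nat).

Lemma nadic1 (x : R) : nadic 1 x -> exists p : nat, x = p%:R.
Proof. by move=> [p [k ->]]; exists p; rewrite expr1n divr1. Qed.

Lemma nadic1_gap (p : nat) (x : R) : p%:R < x < p.+1%:R -> ~ nadic 1 x.
Proof.
move=> + /nadic1[q xE]; rewrite xE !ltr_nat.
by lia.
Qed.

Lemma F1_trivial h (x : R) : F_set 1 r h -> h x = x.
Proof.
move=> [hb hc hm hPL hid]; have [h0 _ _] := homo_cont hb hm.
have [xr|] := boolP (x \in `[0, r%:R]); last exact: hid.
have [_ hS _] := hPL.
suff claim (p : nat) : forall y, 0 <= y <= r%:R -> y <= p%:R -> h y = y.
  move: xr; rewrite in_itv/= => xr; apply: (claim r) => //.
  by case/andP: xr.
elim: p => [|p IH] y /andP[y0 yr] yp.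
  by have -> : y = 0 by lra.
have [/IH->//|py] := leP y p%:R; first by rewrite y0.
have p0 : 0 <= p%:R :> R by exact: ler0n.
have hcy : {within `[p%:R, y], continuous h}.
  by apply: continuous_subspaceW hc; apply: subset_itv; rewrite bnd_simp.
have [z zp|k] := reg_MVT py hcy (n := 1).
  apply: (nadic_PL_reg hPL); first by lra.
  by move=> /hS; apply: (@nadic1_gap p); lra.
rewrite exp1rz mul1r (IH p%:R) ?lexx ?p0//; last by lra.
by lra.
Qed.

Lemma G1_trivial h (x : R) : r = 1%N -> G_set 1 r h -> h x = x.
Proof.
move=> r1 Gh; have [hb hc hPL hZ hid] := Gh.
have [xr|] := boolP (x \in `[0, r%:R[); last exact: hid.
have D0 : (0 : R) \in `[0, r%:R[ by rewrite r1 in_itv/= lexx ltr01.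
have [_ hS _] := hPL.
have [||y|k] := affine_between hPL (G_raff Gh D0) (_ : 0 <= 0 < 1) _.
- by rewrite lexx ltr01.
- by rewrite r1.
- by move=> y01 /hS; exact: (@nadic1_gap 0).
move=> hk; have hx : h x = h 0 + x.
  by rewrite hk ?exp1rz ?mul1r ?subr0//; move: xr; rewrite r1 in_itv.
have [p hp] : exists p : nat, h 0 = p%:R.
  by apply: nadic1; apply: (G_nadic Gh D0).2; exact: nadic0.
have : h 0 \in `[0, r%:R[ by have [hD _ _] := hb; exact: hD.
rewrite in_itv/= hp r1 => /andP[_]; rewrite (ltr_nat R p 1) ltnS leqn0 => /eqP p0.
by rewrite hx hp p0 add0r.
Qed.

End SlopeOne.

Section Sign.
Variables (R : realType) (r : nat) (n_gt0 : (0 < 1)%N).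
Hypothesis r_gt1 : (1 < r)%N.
Notation G := (G_group R r n_gt0).

Let on_naturals (g : G) : exists f : 'I_r -> 'I_r, forall i : 'I_r,
  evG g i%:R = (f i)%:R.
Proof.
suff /choice[f fP] : forall i : 'I_r, exists j : 'I_r, evG g i%:R = j%:R.
  by exists f.
move=> i; have Di : (i%:R : R) \in `[0, r%:R[.
  by rewrite in_itv/= ler0n ltr_nat /=.
have [p gp] : exists p : nat, evG g i%:R = p%:R.
  by apply: nadic1; apply: (G_nadic (evGP g) Di).2; exact: nadic_nat.
have /andP[_] : base r (evG g i%:R).
  by apply: evG_base; rewrite /base /= ler0n ltr_nat /=.
by rewrite gp ltr_nat => pr; exists (Ordinal pr).
Qed.

Let f (g : G) := projT1 (cid (on_naturals g)).

Let fP (g : G) (i : 'I_r) : evG g i%:R = (f g i)%:R.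
Proof. exact: (projT2 (cid (on_naturals g))). Qed.

Let f_inj (g : G) : injective (f g).
Proof.
move=> i j /(congr1 (fun k : 'I_r => k%:R : R)); rewrite -!fP.
move=> /(can_inj (evGK g)) /eqP; rewrite eqr_nat => /eqP; exact: val_inj.
Qed.

(** An element of G_{1,r} permutes the natural numbers below r, and this is the
    sign of that permutation. *)
Definition parity (g : G) : bool := odd_perm (perm (@f_inj g)).

Lemma parityM (g h : G) : parity (g * h)%g = parity g (+) parity h.
Proof.
rewrite /parity addbC -odd_permM; congr odd_perm; apply/permP => i.
rewrite permM !permE; apply/val_inj/eqP; rewrite -(eqr_nat R).
by rewrite -!fP evGM fP -fP.
Qed.

Lemma parity1 : parity 1%g = false.
Proof. by have := parityM 1 1; rewrite mulg1; case: (parity 1%g). Qed.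

Lemma parityV (g : G) : parity g^-1%g = parity g.
Proof. by have := parityM g^-1%g g; rewrite mulVg parity1; do 2 case: parity. Qed.

Definition even : set G := [set g | parity g = false].

Lemma even_normal : normal_subgroup even.
Proof.
split; rewrite /even /=.
- exact: parity1.
- by move=> g h; rewrite parityM => -> ->.
- by move=> g; rewrite parityV.
- by move=> g h gE; rewrite /conjg !parityM parityV gE /= addbb.
Qed.

Lemma even_commutator (g h : G) : even (g^-1 * (h^-1 * (g * h)))%g.
Proof. by rewrite /even /= !parityM !parityV; do 2 case: parity. Qed.

(** The exchange of [0, 1[ and [1, 2[ induces a transposition. *)
Lemma even_proper : even <> setT.
Proof.
have r2 : 2 <= r%:R :> R by rewrite (ler_nat R 2).
have r01 : 0 <= (1 : R) <= r%:R by lra.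
have Z1 : nadic 1 (1 : R) by exact: (nadic_nat R 1 1).
have [rot rotE] := evG_onto n_gt0 (rotation_G n_gt0 r01 Z1).
pose Q := [set x : R | 0 <= x < 1].
have rotQ x : Q x -> evG rot x = x + 1.
  move=> /andP[x0 x1]; rewrite rotE /rotation ltNge x0 /=.
  by rewrite ifT ?ifT//; lra.
have rQ : is_region 1 r Q by apply: is_region_itv => //; [lra|exact: nadic0].
have [|s [sQ sN]] := @region_swap R 1 r n_gt0 rot Q rQ.
  by move=> x Qx; rewrite rotQ//; move: Qx; rewrite /Q /= => x01 x12; lra.
have r0 : (0 < r)%N by lia.
pose i0 : 'I_r := Ordinal r0; pose i1 : 'I_r := Ordinal r_gt1.
have i01 : i0 != i1 by [].
have f0 : f s i0 = i1.
  apply/val_inj/eqP; rewrite -(eqr_nat R) -fP /=.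
  have Q0 : Q 0 by rewrite /Q /= lexx ltr01.
  by rewrite sQ// rotQ// add0r.
have f2 i : i != i0 -> i != i1 -> f s i = i.
  move=> n0 n1; have i2 : (1 < i)%N by move: n0 n1; rewrite -!val_eqE /=; lia.
  have i2' : 2 <= i%:R :> R by rewrite (ler_nat R 2).
  apply/val_inj/eqP; rewrite -(eqr_nat R) -fP sN//; first by rewrite /Q /= => q; lra.
  by move=> [y Qy]; rewrite rotQ//; move: Qy; rewrite /Q /= => q e; lra.
have f1 : f s i1 = i0.
  apply/eqP; apply: contraT => n0; have [e1|n1] := eqVneq (f s i1) i1.
    by move: i01; rewrite -(inj_eq (@f_inj s)) f0 e1 eqxx.
  have /f_inj e1 := f2 _ n0 n1.
  by rewrite e1 eqxx in n1.
move=> ET; have : even s by rewrite ET.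
rewrite /even /= /parity (_ : perm _ = tperm i0 i1) ?odd_tperm//.
apply/permP => i; rewrite permE.
by case: tpermP => [->|->|/eqP n0 /eqP n1]; [exact: f0|exact: f1|exact: f2].
Qed.

End Sign.

(** Simplicity forces the group to be abelian, or is contradicted, in all cases
    but n >= 2 in the second family, where flexibility takes over. *)
Theorem mainTheorem2 (R : realType) (n r : nat)
    (n_gt0 : (0 < n)%N) (r_gt0 : (0 < r)%N) (fam : HT_family)
    (G_simple : simple_group (HT_group fam R r n_gt0))
    (d : measure_display) (X : measurableType d) (mu : probability X R)
    (act : HT_group fam R r n_gt0 -> X -> X)
    (act_mp : mp_action mu act)
    (act_ergodic : ergodic_action mu act)
    (act_nontrivial : ~ trivial_action mu act)
    (mfix_set : forall g, measurable (fix_set act g)) :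
  essentially_free_action mu act.
Proof.
have byab : (forall g h : HT_group fam R r n_gt0, (g * h = h * g)%g) ->
    essentially_free_action mu act.
  by move=> cG; exact: (abelian_essentially_free act_mp mfix_set G_simple cG).
have [n1|n1] := ltnP 1 n.
  case: fam G_simple act act_mp act_ergodic act_nontrivial mfix_set byab
    => /= G_simple act act_mp act_ergodic act_nontrivial mfix_set byab.
    apply: byab; apply: (commutator_quotient_abelian G_simple).
    - exact: trivial_germ_normal.
    - exact: trivial_germ_commutator.
    - exact: trivial_germ_proper.
  exact: (flexible_essentially_free act_mp mfix_set (G_flexible R r n_gt0 n1)
    (G_countable R r n_gt0) G_simple).
have nE : n = 1%N by lia.
move: n_gt0 G_simple act act_mp act_ergodic act_nontrivial mfix_set byab.
rewrite nE => {n nE n1} n_gt0 G_simple act act_mp act_ergodic act_nontrivial mfix_set byab.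
case: fam G_simple act act_mp act_ergodic act_nontrivial mfix_set byab
    => /= G_simple act act_mp act_ergodic act_nontrivial mfix_set byab.
  have [[g g1] _] := G_simple; case: g1; apply: pg_eq => x.
  exact: (F1_trivial x (@pg_funP _ (F_perm R r n_gt0) g)).
have [r1|r1] := ltnP 1 r.
  apply: byab; apply: (commutator_quotient_abelian G_simple).
  - exact: even_normal.
  - exact: even_commutator.
  - exact: even_proper.
have [[g g1] _] := G_simple; case: g1; apply: pg_eq => x.
by apply: (G1_trivial x _ (@pg_funP _ (G_perm R r n_gt0) g)); lia.
Qed.
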